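(* Let $(\mathcal A,\varphi)$ be a non-commutative probability space, let $(a_1,b_1)$ and $(a_2,b_2)$ be bi-free pairs in $(\mathcal A,\varphi)$ with $\varphi(a_j)\varphi(b_j)\neq0$ for $j=1,2$, and let $X_j=\begin{pmatrix}a_j&0\\0&b_j\end{pmatrix}\in M_2(\mathcal A)$. Then the identity $$S_{X_1X_2}(\Gamma)=S_{X_2}(\Gamma)\,S_{X_1}\big(S_{X_2}(\Gamma)^{-1}\,\Gamma\, S_{X_2}(\Gamma)\big)$$ holds for all invertible upper triangular matrices $\Gamma=\begin{pmatrix}z&\zeta\\0&w\end{pmatrix}\in M_2(\mathbb C)$ with $\|\Gamma\|$ small enough if and only if either $S_{a_1,b_1}(z,w)\equiv1$ or $S_{a_2,b_2}(z,w)\equiv1$ for $z$ and $w$ near zero.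
   Context: $\mathcal A$ is a von Neumann algebra and $\varphi$ is a state on it. $E:M_2(\mathcal A)\to M_2(\mathbb C)$ is $E((x_{ij}))=(\varphi(x_{ij}))$. Scalar transforms. For $a,b\in\mathcal A$ with $\varphi(a)\ne0\neq\varphi(b)$: $\Psi_a(z)=\sum_{n\ge1}\varphi(a^n)z^n$, with inverse (under composition) $\Psi_a^{\langle-1\rangle}$ near $0$; $H_{a,b}(z,w)=\sum_{m,n\ge0}\varphi(a^mb^n)z^mw^n$; and the partial bi-free $S$-transform $$S_{a,b}(z,w)=\frac{z+1}{z}\frac{w+1}{w}\left(1-\frac{1+z+w}{H_{a,b}(\Psi_a^{\langle-1\rangle}(z),\Psi_b^{\langle-1\rangle}(w))}\right)$$ for non-zero $z,w$ near $0$ (it extends holomorphically to a neighborhood of $(0,0)$). Matrix-valued transforms. For $X=\begin{pmatrix}a&0\\0&b\end{pmatrix}$ with $\varphi(a)\neq0\neq\varphi(b)$ and upper triangular $\Gamma=\begin{pmatrix}z&\zeta\\0&w\end{pmatrix}\in M_2(\mathbb C)$ with $|z|,|w|$ small, $\Psi_X(\Gamma)=E((1-\Gamma X)^{-1})-1$, which is again upper triangular. $\Psi_X^{\langle-1\rangle}$ denotes the inverse under composition of $\Psi_X$ restricted to upper triangular matrices, defined for $|z|,|w|$ small (any $\zeta\in\mathbb C$). For invertible such $\Gamma$, $S_X(\Gamma)=\Gamma^{-1}(1+\Gamma)\Psi_X^{\langle-1\rangle}(\Gamma)$. Note $X_1X_2=\begin{pmatrix}a_1a_2&0\\0&b_1b_2\end{pmatrix}$.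 Bi-freeness (Voiculescu). A vector space with specified state vector is a triple $(\mathcal X,\mathcal X^\circ,\xi)$ with $\mathcal X=\mathbb C\xi\oplus\mathcal X^\circ$. Given two such triples $(\mathcal X_i,\mathcal X_i^\circ,\xi_i)$, $i=1,2$, their free product is $\mathcal X=\mathbb C\xi\oplus\bigoplus_{n\ge1}\bigoplus_{i_1\ne i_2\ne\cdots\ne i_n}\mathcal X_{i_1}^\circ\otimes\cdots\otimes\mathcal X_{i_n}^\circ$, with functional $\psi:\mathcal X\to\mathbb C$ given by $\psi(\xi)=1$ and $\psi=0$ on the other summands. Let $\mathcal X(\ell,i)$ (resp. $\mathcal X(r,i)$) be the span of $\xi$ and the summands with $i_1\neq i$ (resp. $i_n\ne i$). There are natural identifications $V_i:\mathcal X_i\otimes\mathcal X(\ell,i)\to\mathcal X$ and $W_i:\mathcal X(r,i)\otimes\mathcal X_i\to\mathcal X$ (concatenation of tensors, with $\xi_i$ and $\xi$ acting as empty words), and for a linear operator $T$ on $\mathcal X_i$ one sets $\lambda_i(T)=V_i(T\otimes I)V_i^{-1}$ and $\rho_i(T)=W_i(I\otimes T)W_i^{-1}$. The pairs $(a_1,b_1)$, $(a_2,b_2)$ in $(\mathcal A,\varphi)$ (the $a_i$ being left variables and the $b_i$ right variables) are bi-free if there exist such triples and linear operators $T_i,S_i$ on $\mathcal X_i$ with $\varphi(P(a_1,b_1,a_2,b_2))=\psi(P(\lambda_1(T_1),\rho_1(S_1),\lambda_2(T_2),\rho_2(S_2))\xi)$ for every non-commutative polynomial $P$ in four variables. *)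

(* Defs.v *)
From HB Require Import structures.
From mathcomp Require Import all_boot all_order all_algebra.
From mathcomp Require Import all_classical all_reals all_analysis.
From mathcomp Require Import sesquilinear complex.

Set Implicit Arguments.
Unset Strict Implicit.
Unset Printing Implicit Defensive.

Import Order.TTheory GRing.Theory Num.Theory.
Import numFieldNormedType.Exports.

Local Open Scope classical_set_scope.
Local Open Scope ring_scope.

(* [R[i]], typed as a structure so that the generic topology on numeric fields
   is found. *)
Definition cplx (R : realType) : numClosedFieldType := R[i].

Definition bounded_op (C : numClosedFieldType) (H : normedModType C) :
  set (H -> H) :=
  [set T | linear T /\ exists k : C, forall h, `|T h| <= k * `|h|].

Definition commutant (C : numClosedFieldType) (H : normedModType C)
    (M : set (H -> H)) : set (H -> H) :=
  [set T | bounded_op T /\ forall S, M S -> T \o S = S \o T].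

(* A von Neumann algebra acting on a Hilbert space: [vN_op] identifies the
   abstract *-algebra [vN_alg] with a self-adjoint algebra of bounded operators
   that equals its bicommutant. *)
Record vonNeumannAlgebra (C : numClosedFieldType) := VonNeumannAlgebra {
  vN_alg :> algType C;
  vN_star : vN_alg -> vN_alg;
  vN_space : completeNormedModType C;
  vN_dot : {dot vN_space for (@Num.conj C)};
  vN_op : vN_alg -> vN_space -> vN_space;
  vN_normE : forall h, `|h| ^+ 2 = vN_dot h h;
  vN_op_inj : injective vN_op;
  vN_op1 : forall h, vN_op 1 h = h;
  vN_opM : forall x y h, vN_op (x * y) h = vN_op x (vN_op y h);
  vN_opP : forall (c : C) x y h,
    vN_op (c *: x + y) h = c *: vN_op x h + vN_op y h;
  vN_op_adj : forall x h k,
    vN_dot (vN_op x h) k = vN_dot h (vN_op (vN_star x) k);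
  vN_bicommutant : range vN_op = commutant (commutant (range vN_op)) }.

Section Transforms.
Variables (C : numClosedFieldType) (A : vonNeumannAlgebra C).

Record is_state (phi : {scalar A}) : Prop := IsState {
  state_ge0 : forall x : A, 0 <= phi (vN_star x * x);
  state1 : phi 1 = 1;
  state_norm_le1 : forall (x : A) (k : C),
    (forall h, `|vN_op x h| <= k * `|h|) -> `|phi x| <= k }.

Variable phi : {scalar A}.

Definition Psi (a : A) (z : C) : C :=
  limn (fun N => \sum_(1 <= n < N) phi (a ^+ n) * z ^+ n).

(* [g] is the germ at [0] of the inverse of [f]; the last clause picks the
   branch through [0] and makes the germ unique. *)
Definition is_comp_inverse (f g : C -> C) : Prop :=
  [/\ \forall z \near (0 : C), f (g z) = z,
      \forall z \near (0 : C), g (f z) = z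
    & g z @[z --> (0 : C)] --> (0 : C)].

Definition Psi_inv (a : A) : C -> C := get (is_comp_inverse (Psi a)).

(* The double series converges absolutely for small [z] and [w], so it may be
   summed iteratively. *)
Definition Hseries (a b : A) (z w : C) : C :=
  limn (fun M => \sum_(0 <= m < M)
    limn (fun N => \sum_(0 <= n < N)
      phi (a ^+ m * b ^+ n) * z ^+ m * w ^+ n)).

Definition Spartial (a b : A) (z w : C) : C :=
  (z + 1) / z * ((w + 1) / w) *
  (1 - (1 + z + w) / Hseries a b (Psi_inv a z) (Psi_inv b w)).

Definition diag2 (a b : A) : 'M[A]_2 :=
  \matrix_(i, j) if i != j then 0 else if i == 0 then a else b.

Definition upper2 (z zeta w : C) : 'M[C]_2 :=
  \matrix_(i, j) if i == j then (if i == 0 then z else w)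
                 else if i == 0 then zeta else 0.

Definition is_upper2 (G : 'M[C]_2) : Prop := G 1 0 = 0.

Definition ring_inv (M : 'M[A]_2) : 'M[A]_2 :=
  xget 0 [set Y | M *m Y = 1%:M /\ Y *m M = 1%:M].

Definition E2 (M : 'M[A]_2) : 'M[C]_2 := map_mx phi M.

Definition scal2 (G : 'M[C]_2) : 'M[A]_2 := map_mx (in_alg A) G.

Definition PsiM (X : 'M[A]_2) (G : 'M[C]_2) : 'M[C]_2 :=
  E2 (ring_inv (1%:M - scal2 G *m X)) - 1%:M.

(* Upper triangular matrices with small diagonal and arbitrary off-diagonal
   entry. *)
Definition near_diag0 (P : 'M[C]_2 -> Prop) : Prop :=
  \forall z \near (0 : C) & w \near (0 : C), forall zeta, P (upper2 z zeta w).

Definition is_comp_inverseM (f g : 'M[C]_2 -> 'M[C]_2) : Prop :=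
  [/\ near_diag0 (fun G => is_upper2 (g G)),
      near_diag0 (fun G => f (g G) = G),
      near_diag0 (fun G => g (f G) = G)
    & forall e : C, 0 < e ->
        near_diag0 (fun G => `|g G 0 0| < e /\ `|g G 1 1| < e)].

Definition PsiM_inv (X : 'M[A]_2) : 'M[C]_2 -> 'M[C]_2 :=
  get (is_comp_inverseM (PsiM X)).

Definition SM (X : 'M[A]_2) (G : 'M[C]_2) : 'M[C]_2 :=
  invmx G *m (1%:M + G) *m PsiM_inv X G.

End Transforms.

Record pointedSpace (C : numClosedFieldType) := PointedSpace {
  ps_space :> lmodType C;
  ps_xi : ps_space;
  ps_circ : set ps_space;
  ps_circ0 : ps_circ 0;
  ps_circP : forall (c : C) x y,
    ps_circ x -> ps_circ y -> ps_circ (c *: x + y);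
  ps_direct : forall x, exists! cy : C * ps_space,
    ps_circ cy.2 /\ x = cy.1 *: ps_xi + cy.2 }.

Section FreeProduct.
Variables (C : numClosedFieldType) (X : bool -> pointedSpace C).

Definition word := seq {i : bool & X i}.

Definition letter (i : bool) (x : X i) : {i : bool & X i} :=
  Tagged (fun i => X i) x.

(* Indexes the elementary tensors of the free product; the empty word stands
   for [xi]. *)
Definition reduced (w : word) : Prop :=
  sorted (fun u v => tag u != tag v) w /\
  forall u, u \in w -> ps_circ (tagged u).

Definition starts_with (i : bool) (w : word) : bool :=
  ohead [seq tag u | u <- w] == Some i.

Definition ends_with (i : bool) (w : word) : bool :=
  ohead (rev [seq tag u | u <- w]) == Some i.

Definition multilinear_on_reduced (W : lmodType C) (m : word -> W) : Prop :=
  forall (w1 w2 : word) (i : bool) (c : C) (x y : X i),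
    reduced (w1 ++ letter x :: w2) -> reduced (w1 ++ letter y :: w2) ->
    m (w1 ++ letter (c *: x + y) :: w2) =
    c *: m (w1 ++ letter x :: w2) + m (w1 ++ letter y :: w2).

(* The direct sum of [C xi] and of all alternating tensor products of the
   [ps_circ]'s, given by its universal property: a linear map out of it is a
   family of multilinear maps, one for each alternating index sequence. *)
Record freeProduct := FreeProduct {
  fp_space :> lmodType C;
  fp_tens : word -> fp_space;
  fp_multilinear : multilinear_on_reduced fp_tens;
  fp_lift : forall (W : lmodType C) (m : word -> W),
    multilinear_on_reduced m ->
    exists f : {linear fp_space -> W},
      forall w, reduced w -> f (fp_tens w) = m w;
  fp_lift_unique : forall (W : lmodType C) (f g : {linear fp_space -> W}),
    (forall w, reduced w -> f (fp_tens w) = g (fp_tens w)) -> f =1 g;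
  fp_psi : {scalar fp_space};
  fp_psi_xi : fp_psi (fp_tens [::]) = 1;
  fp_psi_tens : forall w, reduced w -> w != [::] -> fp_psi (fp_tens w) = 0 }.

Variable F : freeProduct.

(* [V_i ((c xi_i + y) (x) w)] and [W_i (w (x) (c xi_i + y))] for [y] in
   [ps_circ]. *)
Definition Vmap (i : bool) (c : C) (y : X i) (w : word) : F :=
  c *: fp_tens F w + fp_tens F (letter y :: w).

Definition Wmap (i : bool) (w : word) (c : C) (y : X i) : F :=
  c *: fp_tens F w + fp_tens F (rcons w (letter y)).

(* [L V_i = V_i (T (x) I)], where [X(l,i)] is spanned by the words that do not
   start with [i]; as [V_i] is onto, this determines [L] from [T]. *)
Definition is_lambda (i : bool) (T : X i -> X i) (L : F -> F) : Prop :=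
  forall w, reduced w -> ~~ starts_with i w ->
  forall (c c' : C) (y y' : X i), ps_circ y -> ps_circ y' ->
    T (c *: ps_xi (X i) + y) = c' *: ps_xi (X i) + y' ->
    L (Vmap c y w) = Vmap c' y' w.

Definition is_rho (i : bool) (S : X i -> X i) (L : F -> F) : Prop :=
  forall w, reduced w -> ~~ ends_with i w ->
  forall (c c' : C) (y y' : X i), ps_circ y -> ps_circ y' ->
    S (c *: ps_xi (X i) + y) = c' *: ps_xi (X i) + y' ->
    L (Wmap w c y) = Wmap w c' y'.

End FreeProduct.

(* Every pair of pointed spaces has a free product: the quotient of the formal
   combinations of words by equality under all multilinear evaluations. *)
Module FreeProductExistence.
Local Open Scope quotient_scope.

Section Existence.
Variables (C : numClosedFieldType) (X : bool -> pointedSpace C).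
Local Notation pre := (seq (C * word X)).

Definition ev (W : lmodType C) (m : word X -> W) (e : pre) : W :=
  \sum_(t <- e | `[< reduced t.2 >]) t.1 *: m t.2.

Definition eqp (e e' : pre) : bool :=
  `[< forall (W : lmodType C) (m : word X -> W),
     multilinear_on_reduced m -> ev m e = ev m e' >].

Lemma eqp_refl : reflexive eqp. Proof. by move=> e; apply/asboolP. Qed.

Lemma eqp_sym : symmetric eqp.
Proof. move=> e f; apply/asboolP/asboolP => h W m hm; exact/esym/h. Qed.

Lemma eqp_trans : transitive eqp.
Proof. move=> f e g /asboolP h /asboolP k; apply/asboolP => W m hm.
by rewrite (h W m hm) (k W m hm). Qed.

Definition eqpr := EquivRel eqp eqp_refl eqp_sym eqp_trans.

Definition fp := {eq_quot eqpr}.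

HB.instance Definition _ := Choice.on fp.

Definition cl (e : pre) : fp := \pi_fp e.

Definition evq (W : lmodType C) (m : word X -> W) (x : fp) : W := ev m (repr x).

Lemma evq_pi W m (e : pre) : multilinear_on_reduced m ->
  @evq W m (cl e) = ev m e.
Proof.
move=> hm; rewrite /evq /cl.
have /asboolP h : eqp (repr (\pi_fp e)) e by apply/(eqmodP eqpr); rewrite reprK.
exact: h.
Qed.

Lemma fpP (x y : fp) : (forall (W : lmodType C) (m : word X -> W),
   multilinear_on_reduced m -> evq m x = evq m y) -> x = y.
Proof.
move=> h; rewrite -[x]reprK -[y]reprK; apply/(eqmodP eqpr)/asboolP => W m hm.
exact: h.
Qed.

Definition fadd (x y : fp) : fp := cl (repr x ++ repr y).

Definition fscale (c : C) (x : fp) : fp := cl [seq (c * t.1, t.2) | t <- repr x].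

Definition fzero : fp := cl [::].

Lemma ev_scale (W : lmodType C) m c (e : pre) :
  @ev W m [seq (c * t.1, t.2) | t <- e] = c *: ev m e.
Proof. by rewrite /ev big_map scaler_sumr; apply: eq_bigr => t _; rewrite scalerA. Qed.

Lemma evq0 W m : multilinear_on_reduced m -> @evq W m fzero = 0.
Proof. by move=> hm; rewrite evq_pi // /ev big_nil. Qed.

Lemma evqD W m x y : multilinear_on_reduced m -> @evq W m (fadd x y) = evq m x + evq m y.
Proof. by move=> hm; rewrite evq_pi // /ev big_cat. Qed.

Lemma evqZ W m c x : multilinear_on_reduced m -> @evq W m (fscale c x) = c *: evq m x.
Proof. by move=> hm; rewrite evq_pi // ev_scale. Qed.

Definition fopp x := fscale (-1) x.

Lemma faddA : associative fadd.
Proof. by move=> x y z; apply: fpP => W m hm; rewrite !evqD// addrA. Qed.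

Lemma faddC : commutative fadd.
Proof. by move=> x y; apply: fpP => W m hm; rewrite !evqD// addrC. Qed.

Lemma fadd0 : left_id fzero fadd.
Proof. by move=> x; apply: fpP => W m hm; rewrite !evqD// evq0// add0r. Qed.

Lemma faddN : left_inverse fzero fopp fadd.
Proof. by move=> x; apply: fpP => W m hm; rewrite !evqD// evqZ// evq0// scaleN1r addNr. Qed.

HB.instance Definition _ := GRing.isZmodule.Build fp faddA faddC fadd0 faddN.

Lemma fscA a b v : fscale a (fscale b v) = fscale (a * b) v.
Proof. by apply: fpP => W m hm; rewrite !evqZ// scalerA. Qed.

Lemma fsc1 : left_id 1 fscale.
Proof. by move=> x; apply: fpP => W m hm; rewrite !evqZ// scale1r. Qed.

Lemma fscDr : right_distributive fscale +%R.
Proof. by move=> a x y; apply: fpP => W m hm; rewrite !(evqZ,evqD)// scalerDr. Qed.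

Lemma fscDl v : {morph fscale^~ v : a b / a + b}.
Proof. by move=> a b; apply: fpP => W m hm; rewrite !(evqZ,evqD)// scalerDl. Qed.

HB.instance Definition _ := GRing.Zmodule_isLmodule.Build C fp fscA fsc1 fscDr fscDl.

Definition ftens (w : word X) : fp := cl [:: (1, w)].

Lemma evq_tens W m w : multilinear_on_reduced m -> reduced w -> @evq W m (ftens w) = m w.
Proof. by move=> hm hw; rewrite evq_pi // /ev big_cons big_nil asboolT //= scale1r addr0. Qed.

Lemma evqL (W : lmodType C) m : multilinear_on_reduced m -> linear (@evq W m).
Proof. by move=> hm c x y; rewrite evqD// evqZ. Qed.

Lemma multi_reduced (w1 w2 : word X) i c (x y : X i) :
  reduced (w1 ++ letter x :: w2) -> reduced (w1 ++ letter y :: w2) ->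
  reduced (w1 ++ letter (c *: x + y) :: w2).
Proof.
move=> [s1 c1] [s2 c2]; split.
  move: s1; have h (u : word X) : sorted (fun u v => tag u != tag v) u
     = sorted (fun i j => i != j) (map tag u) by rewrite sorted_map.
  by rewrite !h !map_cat.
move=> u; rewrite mem_cat inE => /or3P[h|/eqP->|h].
- by apply: c1; rewrite mem_cat h.
- apply: ps_circP; [apply: (c1 (letter x)) | apply: (c2 (letter y))];
  by rewrite mem_cat inE eqxx orbT.
- by apply: c1; rewrite mem_cat inE h !orbT.
Qed.

Lemma tens_multi : multilinear_on_reduced ftens.
Proof.
move=> w1 w2 i c x y h1 h2; apply: fpP => W m hm.
rewrite evqL// !evq_tens//; first exact: hm.
exact: multi_reduced.
Qed.

Lemma fp_gen (x : fp) : x = ev ftens (repr x).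
Proof.
apply: fpP => W m hm; rewrite {1}/evq.
elim: (repr x) => [|t e IH]; rewrite /ev ?big_nil ?evq0// !big_cons.
case: asboolP => h; last exact: IH.
by rewrite evqD// evqZ// evq_tens//; congr (_ + _); exact: IH.
Qed.

Definition psim (w : word X) : C^o := (w == [::])%:R.

Lemma psim_multi : multilinear_on_reduced psim.
Proof.
move=> [|a w1] w2 i c x y _ _; rewrite /psim /= scaler0 addr0//.
Qed.

Lemma red_nil : reduced ([::] : word X). Proof. by split. Qed.

Definition mkl W m (h : linear (@evq W m)) : {linear fp -> W} :=
  HB.pack (@evq W m) (GRing.isLinear.Build C fp W _ _ h).

Definition mkp : {scalar fp} :=
  HB.pack (evq psim : fp -> C)
  (GRing.isLinear.Build C fp C _ (evq psim) (evqL psim_multi)).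

Lemma freeProduct_exists : inhabited (freeProduct X).
Proof.
constructor.
apply: (@FreeProduct C X fp ftens tens_multi _ _ mkp).
- move=> W m hm; exists (mkl (evqL hm)) => w hw; exact: evq_tens.
- move=> W f g h x; rewrite (fp_gen x) /ev !linear_sum; apply: eq_bigr => t /asboolP ht.
  by rewrite !linearZZ h.
- exact: (evq_tens psim_multi red_nil).
- move=> w hw /negbTE hn; rewrite [LHS](evq_tens psim_multi hw).
  by rewrite /psim hn.
Qed.
End Existence.

End FreeProductExistence.

Inductive ncvar := LeftVar of bool | RightVar of bool.

(* A list of monomials with coefficients, to be summed. *)
Definition ncpoly (C : numClosedFieldType) := seq (C * seq ncvar).

Definition ncpoly_eval (C : numClosedFieldType) (B : algType C)
    (v : ncvar -> B) (P : ncpoly C) : B :=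
  \sum_(t <- P) t.1 *: \prod_(x <- t.2) v x.

Definition ncpoly_apply (C : numClosedFieldType) (V : lmodType C)
    (v : ncvar -> V -> V) (P : ncpoly C) (xi : V) : V :=
  \sum_(t <- P) t.1 *: foldr v xi t.2.

(* The pair indices 1 and 2 are [false] and [true]. *)
Definition bifree (C : numClosedFieldType) (A : vonNeumannAlgebra C)
    (phi : {scalar A}) (a1 b1 a2 b2 : A) : Prop :=
  exists (X : bool -> pointedSpace C) (F : freeProduct X)
    (T S : forall i, {linear X i -> X i})
    (lambda rho : bool -> {linear F -> F}),
    [/\ forall i, is_lambda (T i) (lambda i),
        forall i, is_rho (S i) (rho i)
      & forall P : ncpoly C,
          phi (ncpoly_eval (fun x => match x with
                 | LeftVar i => if i then a2 else a1
                 | RightVar i => if i then b2 else b1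
                 end) P) =
          fp_psi F (ncpoly_apply (fun x => match x with
                 | LeftVar i => lambda i : F -> F
                 | RightVar i => rho i : F -> F
                 end) P (fp_tens F [::]))].

(* Main.v *)
Require Import Defs.
From HB Require Import structures.
From mathcomp Require Import all_boot all_order all_algebra.
From mathcomp Require Import all_classical all_reals all_analysis.
From mathcomp Require Import complex ring.

Set Implicit Arguments.
Unset Strict Implicit.
Unset Printing Implicit Defensive.

Import Order.TTheory GRing.Theory Num.Theory.
Import numFieldNormedType.Exports.

Local Open Scope classical_set_scope.
Local Open Scope ring_scope.

(** Put [p = 1 + z], [q = 1 + w], let [x_j], [y_j] be the inverse images of
    [z], [w] under the moment series of [a_j], [b_j], and let
    [R_j = (1 - x_j a_j)^-1 = p + u_j] and [Q_j = (1 - y_j b_j)^-1 = q + v_j],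
    so that [u_j] and [v_j] are centered.  With [rho = x_1 x_2 p / z] one has
    [R_1 (1 - rho a_1 a_2) R_2 = p (1 - u_1 u_2 / (z p))], so the resolvent of
    [a_1 a_2] at [rho] is a convergent sum of alternating centered words, and
    similarly for [b_1 b_2].  In the free product model, left and right
    alternating centered words pair to zero unless their letters match, and
    then the pairing is the product of the pairings of the letters.  Summing the
    resulting geometric series expresses the moment [H] of the product pair by
    [H_1], [H_2], namely [H (z w p q - k_1 k_2) = z w H_1 H_2] where
    [k_j = H_j - p q].

    The matrix transforms are explicit for upper triangular arguments: the
    identity always holds on the diagonal, and its off-diagonal entry reduces by
    the formula for [H] to [k_1 k_2 = 0].  On the other hand [S_{a_j,b_j} = 1]
    amounts to [k_j = 0].  Each [k_j] either vanishes identically or, for every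
    small [w <> 0], is nonzero for all small [z <> 0]; hence a product
    [k_1 k_2] that vanishes near the origin has a vanishing factor. *)

(** Bi-freeness controls only alternating words in centered letters. Powers of [a_1 a_2] are not of
    this kind, but the resolvent becomes so once [R_1] and [R_2] are pulled out, because the middle
    factor is then a Neumann series in [u_1 u_2]. The value of [rho] is forced:
    [R_1 (1 - s a_1 a_2) R_2] contains [u_1 + u_2] with coefficient [p - s z / (x_1 x_2)], and [rho]
    is the [s] that cancels it. Resolvents are limits of polynomials, so the identities for words
    have to be carried to norm closures.

    No function theory is used. The scalars form an abstract closed field in which powers of [2^-1]
    become small and geometric sequences converge. Inverse functions come from a contraction, and
    the identity theorem is replaced by leading coefficients of bounded functionals on resolvents,
    taken in one variable at a time. This is why, in the dichotomy for [k_j], the radius in [z] may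
    depend on [w]. *)

(** * Non-commutative polynomials and their action *)

Section NCPoly.
Variable C : numClosedFieldType.

Definition ncpoly_lin (c : C) (P Q : ncpoly C) : ncpoly C :=
  [seq (c * t.1, t.2) | t <- P] ++ Q.

Definition ncpoly_mul (P Q : ncpoly C) : ncpoly C :=
  [seq (t.1 * s.1, t.2 ++ s.2) | t <- P, s <- Q].

Lemma ncpoly_eval_lin (B : algType C) (v : ncvar -> B) c P Q :
  ncpoly_eval v (ncpoly_lin c P Q) = c *: ncpoly_eval v P + ncpoly_eval v Q.
Proof.
rewrite /ncpoly_eval big_cat big_map; congr (_ + _).
by rewrite scaler_sumr; apply: eq_bigr => t _; rewrite scalerA.
Qed.

Lemma ncpoly_eval_mul (B : algType C) (v : ncvar -> B) P Q :
  ncpoly_eval v (ncpoly_mul P Q) = ncpoly_eval v P * ncpoly_eval v Q.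
Proof.
rewrite /ncpoly_eval big_allpairs_dep mulr_suml; apply: eq_bigr => t _.
rewrite mulr_sumr; apply: eq_bigr => s _.
by rewrite big_cat -scalerAl -scalerAr scalerA.
Qed.

Lemma ncpoly_apply_lin (V : lmodType C) (f : ncvar -> V -> V) c P Q xi :
  ncpoly_apply f (ncpoly_lin c P Q) xi =
  c *: ncpoly_apply f P xi + ncpoly_apply f Q xi.
Proof.
rewrite /ncpoly_apply big_cat big_map; congr (_ + _).
by rewrite scaler_sumr; apply: eq_bigr => t _; rewrite scalerA.
Qed.

Section Apply.
Variables (V : lmodType C) (f : ncvar -> V -> V).
Hypothesis f_linear : forall x, linear (f x).

Lemma foldr_linear m : linear (fun xi => foldr f xi m).
Proof. by elim: m => [//|x m IH] c u v /=; rewrite IH f_linear. Qed.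

Lemma ncpoly_apply_linear P : linear (ncpoly_apply f P).
Proof.
move=> c u v; rewrite /ncpoly_apply scaler_sumr -big_split /=.
apply: eq_bigr => t _.
by rewrite foldr_linear scalerDr !scalerA mulrC.
Qed.

Lemma ncpoly_apply_sum (I : Type) (r : seq I) (c : I -> C) (g : I -> V) P :
  ncpoly_apply f P (\sum_(i <- r) c i *: g i) =
  \sum_(i <- r) c i *: ncpoly_apply f P (g i).
Proof.
elim: r => [|i r IH]; last by rewrite !big_cons ncpoly_apply_linear IH.
rewrite !big_nil; have := ncpoly_apply_linear P (-1) 0 0.
by rewrite scaler0 addr0 scaleN1r addNr.
Qed.

Lemma ncpoly_apply_mul P Q xi :
  ncpoly_apply f (ncpoly_mul P Q) xi = ncpoly_apply f P (ncpoly_apply f Q xi).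
Proof.
rewrite [in RHS]/ncpoly_apply /ncpoly_apply big_allpairs_dep.
apply: eq_bigr => t _.
(* A single monomial is read as a polynomial, so that linearity of [ncpoly_apply] moves it inside
   the sum. *)
have -> : foldr f (\sum_(t0 <- Q) t0.1 *: foldr f xi t0.2) t.2 =
  ncpoly_apply f [:: (1, t.2)] (\sum_(t0 <- Q) t0.1 *: foldr f xi t0.2).
  by rewrite /ncpoly_apply big_seq1 scale1r.
rewrite ncpoly_apply_sum scaler_sumr; apply: eq_bigr => s _.
by rewrite /ncpoly_apply big_seq1 scale1r scalerA foldr_cat.
Qed.

End Apply.
End NCPoly.

Section CenteredWords.
Variables (C : numClosedFieldType) (A : algType C) (phi : A -> C).

(* The index [i] is the letter that may be appended: a further centered factor
   in [a i] keeps every product alternating. *)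
Inductive centered_words (a : bool -> A) : bool -> A -> Prop :=
| cw1 i : centered_words a i 1
| cw_lin i c x y : centered_words a i x -> centered_words a i y ->
    centered_words a i (c *: x + y)
| cw_mul i x p : centered_words a i x -> phi (horner_alg (a i) p) = 0 ->
    centered_words a (~~ i) (x * horner_alg (a i) p).

End CenteredWords.

(** * Alternating centered words in the free product *)

Section PointedSpace.
Variables (C : numClosedFieldType) (X : pointedSpace C).

Lemma ps_decomp (x : X) :
  exists cy : C * X, ps_circ cy.2 /\ x = cy.1 *: ps_xi X + cy.2.
Proof. by case: (ps_direct x) => cy [h _]; exists cy. Qed.

Definition ps_coef (x : X) : C := (projT1 (cid (ps_decomp x))).1.
Definition ps_rest (x : X) : X := (projT1 (cid (ps_decomp x))).2.

Lemma ps_rest_circ x : ps_circ (ps_rest x).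
Proof. by rewrite /ps_rest; case: cid => ? []. Qed.

Lemma ps_decompE x : x = ps_coef x *: ps_xi X + ps_rest x.
Proof. by rewrite /ps_coef /ps_rest; case: cid => ? []. Qed.

Lemma ps_decomp_uniq x c y :
  ps_circ y -> x = c *: ps_xi X + y -> ps_coef x = c /\ ps_rest x = y.
Proof.
move=> hy hx; case: (ps_direct x) => cy [_ uniq].
have h1 := uniq (c, y) (conj hy hx).
have h2 := uniq (ps_coef x, ps_rest x) (conj (ps_rest_circ x) (ps_decompE x)).
by move: h2; rewrite h1 => -[-> ->].
Qed.

Lemma ps_decomp_lin c x y :
  ps_coef (c *: x + y) = c * ps_coef x + ps_coef y /\
  ps_rest (c *: x + y) = c *: ps_rest x + ps_rest y.
Proof.
apply: ps_decomp_uniq; first by apply: ps_circP; exact: ps_rest_circ.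
rewrite {1}(ps_decompE x) {1}(ps_decompE y) scalerDr scalerDl scalerA.
by rewrite addrACA.
Qed.

Lemma ps_decomp_circ y : ps_circ y -> ps_coef y = 0 /\ ps_rest y = y.
Proof. by move=> hy; apply: ps_decomp_uniq; rewrite ?scale0r ?add0r. Qed.

Lemma ps_decomp_xi : ps_coef (ps_xi X) = 1 /\ ps_rest (ps_xi X) = 0.
Proof.
by apply: ps_decomp_uniq; [exact: ps_circ0 | rewrite scale1r addr0].
Qed.

End PointedSpace.

Section Words.
Variables (C : numClosedFieldType) (X : bool -> pointedSpace C).
Implicit Types w : word X.

Lemma reduced_nil : reduced ([::] : word X). Proof. by split. Qed.

Lemma reduced_letter i (x : X i) w : ps_circ x -> reduced w ->
  ~~ starts_with i w -> reduced (letter x :: w).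
Proof.
move=> hx [sw cw] hs; split; last first.
  by move=> u; rewrite inE => /orP[/eqP -> //|]; exact: cw.
by case: w sw hs {cw} => //= v w ->; rewrite andbT /starts_with /= eq_sym.
Qed.

Lemma reduced_rest i (x : X i) w : reduced w -> ~~ starts_with i w ->
  reduced (letter (ps_rest x) :: w).
Proof. by apply: reduced_letter; exact: ps_rest_circ. Qed.

Lemma starts_with_letter i (x : X i) j w : starts_with j (letter x :: w) = (i == j).
Proof. by []. Qed.

Lemma ends_with_rcons i (x : X i) j w : ends_with j (rcons w (letter x)) = (i == j).
Proof. by rewrite /ends_with map_rcons rev_rcons. Qed.

Lemma ends_with_cons v i w : w != [::] -> ends_with i (v :: w) = ends_with i w.
Proof. by case/lastP: w => // w u _; rewrite /ends_with -rcons_cons !map_rcons !rev_rcons. Qed.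

Lemma starts_with_cat i w1 w2 : w1 != [::] ->
  starts_with i (w1 ++ w2) = starts_with i w1.
Proof. by case: w1. Qed.

Lemma reduced_tail u w : reduced (u :: w) -> reduced w.
Proof.
move=> [s c]; split; first exact: path_sorted s.
by move=> v hv; apply: c; rewrite inE hv orbT.
Qed.

Lemma reduced_cat i w1 w2 : reduced w1 -> reduced w2 ->
  ends_with i w1 -> ~~ starts_with i w2 -> reduced (w1 ++ w2).
Proof.
move=> + r2 + s2; elim: w1 => [//|u w1 IH] r1 e1.
have [w10|w10] := eqVneq w1 [::].
  move: r1 e1; rewrite w10 /= => r1 e1.
  move: e1; rewrite /ends_with /= => /eqP [e1]; move: s2; rewrite -e1.
  move: u r1 {e1} => [j x] [_ cx].
  by apply: reduced_letter => //; apply: (cx (letter x)); rewrite inE.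
have r1' := reduced_tail r1.
rewrite ends_with_cons // in e1.
move: (IH r1' e1) => rw.
move: u r1 => [j x] [sx cx] /=.
apply: (@reduced_letter j x) => //.
  by apply: (cx (letter x)); rewrite inE eqxx.
rewrite starts_with_cat //; move: sx.
by case: (w1) w10 => //= v w1' _ /andP[]; rewrite /starts_with /= eq_sym.
Qed.

Lemma reduced_rcons i (x : X i) w : ps_circ x -> reduced w ->
  ~~ ends_with i w -> reduced (rcons w (letter x)).
Proof.
move=> hx rw ew; rewrite -cats1.
have rx : reduced [:: letter x] by apply: reduced_letter.
case: (eqVneq w [::]) => [-> //|w0].
apply: (@reduced_cat (~~ i)) => //; last first.
  by rewrite starts_with_letter; case: (i).
move: ew; case/lastP: w w0 {rw} => // w [j y] _.
by rewrite !ends_with_rcons; case: i x hx rx; case: j y.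
Qed.

End Words.

Section Model.
Variables (C : numClosedFieldType) (X : bool -> pointedSpace C).
Variable F : freeProduct X.
Variables (T S : forall i, {linear X i -> X i}).
Variables lam rho : bool -> {linear F -> F}.
Hypothesis lamP : forall i, is_lambda (T i) (lam i).
Hypothesis rhoP : forall i, is_rho (S i) (rho i).

(** The vectors [V_i (x tensor w)] and [W_i (w tensor x)] for an arbitrary [x], not only one in
    [ps_circ]. In this form [lam i] and [rho i] act on [x] alone. *)
Definition lins i (w : word X) (x : X i) : F := Vmap F (ps_coef x) (ps_rest x) w.
Definition rins i (w : word X) (x : X i) : F := Wmap F w (ps_coef x) (ps_rest x).

Lemma lins_linear i w : reduced w -> ~~ starts_with i w -> linear (@lins i w).
Proof.
move=> rw sw c x y; rewrite /lins /Vmap.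
have [-> ->] := ps_decomp_lin c x y.
rewrite (@fp_multilinear _ _ F [::] w i c (ps_rest x) (ps_rest y));
  try exact: reduced_rest.
by rewrite scalerDl scalerDr scalerA addrACA.
Qed.

Lemma rins_linear i w : reduced w -> ~~ ends_with i w -> linear (@rins i w).
Proof.
move=> rw sw c x y; rewrite /rins /Wmap -!cats1.
have [-> ->] := ps_decomp_lin c x y.
rewrite (@fp_multilinear _ _ F w [::] i c (ps_rest x) (ps_rest y));
  try by rewrite cats1; apply: reduced_rcons => //; exact: ps_rest_circ.
by rewrite scalerDl scalerDr scalerA addrACA.
Qed.

(** Zero lies in [ps_circ], so it is a legitimate letter, and it does occur: it is the [ps_rest] of
    [ps_xi]. Multilinearity kills such a word. *)
Lemma tens_letter0 i w : reduced w -> ~~ starts_with i w ->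
  fp_tens F (letter (0 : X i) :: w) = 0.
Proof.
move=> rw sw; have r0 : reduced (letter (0 : X i) :: w).
  by apply: reduced_letter => //; exact: ps_circ0.
have := @fp_multilinear _ _ F [::] w i (-1) 0 0 r0 r0.
by rewrite /= scaler0 addr0 scaleN1r addNr.
Qed.

Lemma tens_rletter0 i w : reduced w -> ~~ ends_with i w ->
  fp_tens F (rcons w (letter (0 : X i))) = 0.
Proof.
move=> rw sw; have r0 : reduced (rcons w (letter (0 : X i))).
  by apply: reduced_rcons => //; exact: ps_circ0.
rewrite -cats1 in r0 *.
have := @fp_multilinear _ _ F w [::] i (-1) 0 0 r0 r0.
by rewrite /= scaler0 addr0 scaleN1r addNr.
Qed.

Lemma lins_xi i w : reduced w -> ~~ starts_with i w ->
  lins w (ps_xi (X i)) = fp_tens F w.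
Proof.
move=> rw sw; rewrite /lins /Vmap; have [-> ->] := ps_decomp_xi (X i).
by rewrite tens_letter0 // scale1r addr0.
Qed.

Lemma rins_xi i w : reduced w -> ~~ ends_with i w ->
  rins w (ps_xi (X i)) = fp_tens F w.
Proof.
move=> rw sw; rewrite /rins /Wmap; have [-> ->] := ps_decomp_xi (X i).
by rewrite tens_rletter0 // scale1r addr0.
Qed.

Lemma lins_circ i w (x : X i) : ps_circ x ->
  lins w x = fp_tens F (letter x :: w).
Proof.
by move=> hx; rewrite /lins /Vmap; have [-> ->] := ps_decomp_circ hx;
  rewrite scale0r add0r.
Qed.

Lemma rins_circ i w (x : X i) : ps_circ x ->
  rins w x = fp_tens F (rcons w (letter x)).
Proof.
by move=> hx; rewrite /rins /Wmap; have [-> ->] := ps_decomp_circ hx;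
  rewrite scale0r add0r.
Qed.

Lemma psi_lins i (x : X i) : fp_psi F (lins [::] x) = ps_coef x.
Proof.
rewrite /lins /Vmap linearP fp_psi_xi fp_psi_tens //.
  by rewrite addr0 mulr1.
by apply: reduced_rest => //; exact: reduced_nil.
Qed.

Lemma psi_rins i (x : X i) : fp_psi F (rins [::] x) = ps_coef x.
Proof. by rewrite -psi_lins. Qed.

Lemma lam_lins i w x : reduced w -> ~~ starts_with i w ->
  lam i (lins w x) = lins w (T i x).
Proof.
move=> rw sw; rewrite /lins; apply: lamP => //; try exact: ps_rest_circ.
by rewrite -!ps_decompE.
Qed.

Lemma rho_rins i w x : reduced w -> ~~ ends_with i w ->
  rho i (rins w x) = rins w (S i x).
Proof.
move=> rw sw; rewrite /rins; apply: rhoP => //; try exact: ps_rest_circ.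
by rewrite -!ps_decompE.
Qed.

Variables (A : algType C) (phi : A -> C) (a b : bool -> A).

Definition bivar x := match x with LeftVar i => a i | RightVar i => b i end.
Definition biop x : F -> F :=
  match x with LeftVar i => lam i | RightVar i => rho i end.
Local Notation ev := (ncpoly_eval bivar).
Local Notation act := (ncpoly_apply biop).
Local Notation xi := (fp_tens F [::]).

Hypothesis phi_act : forall P : ncpoly C, phi (ev P) = fp_psi F (act P xi).

Lemma biop_linear x : linear (biop x).
Proof. by case: x => i c u v /=; rewrite linearP. Qed.

Let act_lin := ncpoly_apply_linear biop_linear.
Let act_mul := ncpoly_apply_mul biop_linear.
Let act_sum := ncpoly_apply_sum biop_linear.

Lemma horner_alg_mulX (B : algType C) (x : B) (p : {poly C}) c :
  horner_alg x (p * 'X + c%:P) = horner_alg x p * x + c%:A.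
Proof. by rewrite rmorphD rmorphM /= horner_algC horner_algX. Qed.

(** Every power of [lam i] touches only the leftmost tensor factor, so a whole polynomial does too.
    The induction is on [p * 'X + c], where the operator [T i] is applied before the action of
    [p]. *)
Lemma left_poly i p : exists P (t : X i -> X i), ev P = horner_alg (a i) p /\
  forall w v, reduced w -> ~~ starts_with i w ->
    act P (lins w v) = lins w (t v).
Proof.
elim/poly_ind: p => [|p c [P [t [eP aP]]]].
  exists [::], (fun=> 0); split; first by rewrite rmorph0 /ncpoly_eval big_nil.
  move=> w v rw sw; rewrite /ncpoly_apply big_nil.
  have := lins_linear rw sw (-1) 0 0.
  by rewrite scaler0 addr0 scaleN1r addNr => ->.
exists (ncpoly_lin c [:: (1, [::])] (ncpoly_mul P [:: (1, [:: LeftVar i])])).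
exists (fun v => c *: v + t (T i v)); split.
  rewrite ncpoly_eval_lin ncpoly_eval_mul eP horner_alg_mulX addrC.
  by rewrite /ncpoly_eval !big_seq1 /= big_nil ?big_seq1 !scale1r.
move=> w v rw sw; rewrite ncpoly_apply_lin act_mul.
rewrite [in act _ (act _ _)]/ncpoly_apply /= /ncpoly_apply !big_seq1 /= !scale1r.
by rewrite lam_lins // lins_linear // -/(act P _) aP.
Qed.

Lemma right_poly i p : exists P (t : X i -> X i), ev P = horner_alg (b i) p /\
  forall w v, reduced w -> ~~ ends_with i w ->
    act P (rins w v) = rins w (t v).
Proof.
elim/poly_ind: p => [|p c [P [t [eP aP]]]].
  exists [::], (fun=> 0); split; first by rewrite rmorph0 /ncpoly_eval big_nil.
  move=> w v rw sw; rewrite /ncpoly_apply big_nil.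
  have := rins_linear rw sw (-1) 0 0.
  by rewrite scaler0 addr0 scaleN1r addNr => ->.
exists (ncpoly_lin c [:: (1, [::])] (ncpoly_mul P [:: (1, [:: RightVar i])])).
exists (fun v => c *: v + t (S i v)); split.
  rewrite ncpoly_eval_lin ncpoly_eval_mul eP horner_alg_mulX addrC.
  by rewrite /ncpoly_eval !big_seq1 /= big_nil ?big_seq1 !scale1r.
move=> w v rw sw; rewrite ncpoly_apply_lin act_mul.
rewrite [in act _ (act _ _)]/ncpoly_apply /= /ncpoly_apply !big_seq1 /= !scale1r.
by rewrite rho_rins // rins_linear // -/(act P _) aP.
Qed.

(** The component of [t (ps_xi (X i))] along [ps_xi] is the moment of [p], which is zero. Hence a
    centered polynomial is a pure creation operator on words that do not start with [i]. *)
Lemma left_centered i p : phi (horner_alg (a i) p) = 0 ->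
  exists P (t : X i -> X i), [/\ ev P = horner_alg (a i) p,
    forall w v, reduced w -> ~~ starts_with i w -> act P (lins w v) = lins w (t v),
    ps_circ (t (ps_xi (X i))) &
    forall w, reduced w -> ~~ starts_with i w ->
      act P (fp_tens F w) = fp_tens F (letter (t (ps_xi (X i))) :: w)].
Proof.
move=> p0; have [P [t [eP aP]]] := left_poly i p.
have c0 : ps_circ (t (ps_xi (X i))).
  rewrite (ps_decompE (t _)) (_ : ps_coef _ = 0).
    by rewrite scale0r add0r; exact: ps_rest_circ.
  by rewrite -psi_lins -aP // lins_xi // -phi_act eP.
by exists P, t; split=> // w rw sw; rewrite -lins_circ // -aP // lins_xi.
Qed.

Lemma right_centered i p : phi (horner_alg (b i) p) = 0 ->
  exists P (s : X i), [/\ ev P = horner_alg (b i) p, ps_circ s &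
    forall w, reduced w -> ~~ ends_with i w ->
      act P (fp_tens F w) = fp_tens F (rcons w (letter s))].
Proof.
move=> p0; have [P [t [eP aP]]] := right_poly i p.
have c0 : ps_circ (t (ps_xi (X i))).
  rewrite (ps_decompE (t _)) (_ : ps_coef _ = 0).
    by rewrite scale0r add0r; exact: ps_rest_circ.
  by rewrite -psi_rins -aP // rins_xi // -phi_act eP.
by exists P, (t (ps_xi (X i))); split=> // w rw sw; rewrite -rins_circ // -aP // rins_xi.
Qed.

(** The rightmost factor acts first and has index [~~ i], so on a word starting with [i] it creates
    a new first letter. The next factor has index [i] and does the same, and so on: the empty word
    is never reached. *)
Lemma left_words i x : centered_words phi a i x -> exists2 P, ev P = x &
  forall w, reduced w -> starts_with i w -> fp_psi F (act P (fp_tens F w)) = 0.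
Proof.
elim=> {i x} [i|i c x y _ [P eP hP] _ [Q eQ hQ]|i x p _ [P eP hP] p0].
- exists [:: (1, [::])].
    by rewrite /ncpoly_eval big_seq1 big_nil scale1r.
  move=> w rw sw; rewrite /ncpoly_apply big_seq1 scale1r /=.
  by apply: fp_psi_tens => //; case: w sw {rw}.
- exists (ncpoly_lin c P Q); first by rewrite ncpoly_eval_lin eP eQ.
  by move=> w rw sw; rewrite ncpoly_apply_lin linearP hP // hQ // mulr0 addr0.
- have [Q [t [eQ _ ct aQ]]] := left_centered p0.
  exists (ncpoly_mul P Q); first by rewrite ncpoly_eval_mul eP eQ.
  move=> w rw sw; rewrite act_mul.
  have sw' : ~~ starts_with i w.
    by move: sw; rewrite /starts_with => /eqP ->; case: (i).
  rewrite aQ // hP //; first exact: reduced_letter.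
  exact/eqP.
Qed.

(** Right variables create letters at the far end. The list [e] of created words is therefore the
    same whether the action starts from [xi] or from any [w] ending with [i], and this common list
    is what lets two moments be compared term by term. *)
Lemma right_words i y : centered_words phi b i y ->
  exists P (e : seq (C * word X)), [/\ ev P = y,
    forall t, t \in e -> reduced t.2 /\ ~~ starts_with i t.2,
    act P xi = \sum_(t <- e) t.1 *: fp_tens F t.2 &
    forall w, reduced w -> ends_with i w ->
      act P (fp_tens F w) = \sum_(t <- e) t.1 *: fp_tens F (w ++ t.2)].
Proof.
elim=> {i y} [i|i c x y _ [P [e [eP re hP hP']]] _ [Q [f [eQ rf hQ hQ']]]
  |i x p _ [P [e [eP re hP hP']]] p0].
- exists [:: (1, [::])], [:: (1, [::])]; split.
  + by rewrite /ncpoly_eval big_seq1 big_nil scale1r.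
  + by move=> t; rewrite inE => /eqP -> /=; split=> //; exact: reduced_nil.
  + by rewrite /ncpoly_apply !big_seq1.
  + by move=> w _ _; rewrite /ncpoly_apply !big_seq1 cats0.
- exists (ncpoly_lin c P Q), ([seq (c * t.1, t.2) | t <- e] ++ f); split.
  + by rewrite ncpoly_eval_lin eP eQ.
  + move=> t; rewrite mem_cat => /orP[/mapP[s /re se -> //]|]; exact: rf.
  + rewrite ncpoly_apply_lin hP hQ big_cat big_map scaler_sumr; congr (_ + _).
    by apply: eq_bigr => t _; rewrite scalerA.
  + move=> w rw ew; rewrite ncpoly_apply_lin hP' // hQ' // big_cat big_map scaler_sumr.
    by congr (_ + _); apply: eq_bigr => t _; rewrite scalerA.
- have [Q [s [eQ cs aQ]]] := right_centered p0.
  have rs : reduced [:: letter s] by apply: reduced_letter => //; exact: reduced_nil.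
  exists (ncpoly_mul P Q), [seq (t.1, letter s :: t.2) | t <- e]; split.
  + by rewrite ncpoly_eval_mul eP eQ.
  + move=> t /mapP[u /re [ru su] ->]; split; first exact: reduced_letter.
    by rewrite starts_with_letter; case: (i).
  + have es : ends_with i [:: letter s].
      by rewrite (@ends_with_rcons _ _ i s i [::]) eqxx.
    by rewrite act_mul (aQ _ (@reduced_nil _ X)) // (hP' _ rs es) big_map.
  + move=> w rw ew.
    have ew' : ~~ ends_with i w.
      by move: ew; rewrite /ends_with => /eqP ->; case: (i).
    rewrite act_mul aQ // hP'; last by rewrite ends_with_rcons eqxx.
      by rewrite big_map; apply: eq_bigr => t _; rewrite cat_rcons.
    exact: reduced_rcons.
Qed.

Lemma psi_sum (I : Type) (r : seq I) (c : I -> C) (g : I -> F) :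
  fp_psi F (\sum_(t <- r) c t *: g t) = \sum_(t <- r) c t * fp_psi F (g t).
Proof. by rewrite linear_sum; apply: eq_bigr => t _; rewrite linearZ. Qed.

(** The right word produces words that do not start with [i]; the extra left factor prefixes a
    letter [i], which [x] cannot remove by [left_words]. *)
Lemma centered_words_left0 i x y p :
  centered_words phi a i x -> centered_words phi b i y ->
  phi (horner_alg (a i) p) = 0 -> phi (x * horner_alg (a i) p * y) = 0.
Proof.
move=> /left_words [P <- hP] /right_words [Q [e [<- re hQ _]]] p0.
have [U [t [<- _ ct aU]]] := left_centered p0.
rewrite -!ncpoly_eval_mul phi_act !act_mul hQ !act_sum psi_sum big_seq big1 // => u /re[ru su].
rewrite aU // hP ?mulr0 //; first exact: reduced_letter.
by rewrite starts_with_letter eqxx.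
Qed.

Lemma centered_words_right0 i x y p :
  centered_words phi a i x -> centered_words phi b i y ->
  phi (horner_alg (b i) p) = 0 -> phi (x * (y * horner_alg (b i) p)) = 0.
Proof.
move=> /left_words [P <- hP] /right_words [Q [e [<- re _ hQ]]] p0.
have [U [s [<- cs aU]]] := right_centered p0.
have rs : reduced [:: letter s] by apply: reduced_letter => //; exact: reduced_nil.
have es : ends_with i [:: letter s] by rewrite (@ends_with_rcons _ _ i s i [::]) eqxx.
rewrite -!ncpoly_eval_mul phi_act !act_mul (aU _ (@reduced_nil _ X)) //.
rewrite hQ // act_sum psi_sum big_seq big1 // => u /re[ru su].
by rewrite hP ?mulr0 //; exact: reduced_letter.
Qed.

(** The letter [s] created by the last right factor stays leftmost, because [y] only adds letters
    behind it. The left factor thus acts on [s] itself: the component along [ps_xi] is the moment of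
    the two letters and removes [s], and the rest keeps a first letter [i] and is killed by [x]. *)
Lemma centered_words_pair i x y p r :
  centered_words phi a i x -> centered_words phi b i y ->
  phi (horner_alg (a i) p) = 0 -> phi (horner_alg (b i) r) = 0 ->
  phi (x * horner_alg (a i) p * (y * horner_alg (b i) r)) =
  phi (horner_alg (a i) p * horner_alg (b i) r) * phi (x * y).
Proof.
move=> /left_words [P <- hP] /right_words [Q [e [<- re hQ0 hQ]]] p0 r0.
have [U [s [<- cs aU]]] := right_centered r0.
have [Z [t [<- aZ ct aZ0]]] := left_centered p0.
have rs : reduced [:: letter s] by apply: reduced_letter => //; exact: reduced_nil.
have es : ends_with i [:: letter s] by rewrite (@ends_with_rcons _ _ i s i [::]) eqxx.
have aUx : act U xi = fp_tens F [:: letter s] by rewrite aU //; exact: reduced_nil.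
rewrite -!ncpoly_eval_mul !phi_act !act_mul aUx hQ // hQ0 !act_sum !(psi_sum e).
rewrite mulr_sumr !big_seq; apply: eq_bigr => u /re[ru su].
rewrite mulrCA; congr (_ * _); rewrite /=.
rewrite -[fp_tens F (_ :: u.2)]lins_circ // aZ //.
rewrite -[fp_tens F [:: _]]lins_circ // (aZ _ _ (@reduced_nil _ X)) // psi_lins.
rewrite /lins /Vmap ncpoly_apply_linear; last exact: biop_linear.
by rewrite linearP /= (hP (letter _ :: _)) ?addr0 //; exact: reduced_rest.
Qed.

End Model.

Section Bifree.
Variables (C : numClosedFieldType) (A : vonNeumannAlgebra C) (phi : {scalar A}).
Variables (a b : bool -> A).
Hypothesis ab_bifree : bifree phi (a false) (b false) (a true) (b true).

Lemma bifree_words i x y p r :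
  centered_words phi a i x -> centered_words phi b i y ->
  phi (horner_alg (a i) p) = 0 -> phi (horner_alg (b i) r) = 0 ->
  [/\ phi (x * horner_alg (a i) p * y) = 0,
      phi (x * (y * horner_alg (b i) r)) = 0 &
      phi (x * horner_alg (a i) p * (y * horner_alg (b i) r)) =
      phi (horner_alg (a i) p * horner_alg (b i) r) * phi (x * y)].
Proof.
case: ab_bifree => X [F [T [S [lam [rho [hl hr hphi]]]]]] cx cy p0 r0.
have hphi' (P : ncpoly C) : phi (ncpoly_eval (bivar a b) P) =
    fp_psi F (ncpoly_apply (biop lam rho) P (fp_tens F [::])).
  rewrite -[RHS]hphi; congr (phi (ncpoly_eval _ _)).
  by apply/funext => -[[]|[]].
split.
- exact: (centered_words_left0 hl hr hphi').
- exact: (centered_words_right0 hl hr hphi').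
- exact: (centered_words_pair hl hr hphi').
Qed.

End Bifree.

(** * Resolvents in a von Neumann algebra *)

(** The Archimedean property in the only form used. It is a hypothesis here because [C] is an
    abstract closed field, and is verified for the complex numbers at the end. *)
Definition pow2_small (C : numFieldType) :=
  forall e : C, 0 < e -> exists n, (2^-1) ^+ n < e.

(** Completeness tested on geometric sequences, with a rate of convergence. It is shared by the
    Hilbert space, complete by assumption, and by the scalars, where it is checked on real and
    imaginary parts. *)
Definition geometric_complete (C : numFieldType) (V : normedModType C) :=
  forall (s : nat -> V) (k : C),
    (forall n, `|s n.+1 - s n| <= k * (2^-1) ^+ n) ->
    exists l, exists K : C, forall n, `|l - s n| <= K * (2^-1) ^+ n.

Section GeometricSequences.
Variable C : numFieldType.
Hypothesis C_pow2 : pow2_small C.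

Lemma pow2_small_mul (K e : C) : 0 <= K -> 0 < e ->
  exists n, K * (2^-1) ^+ n < e.
Proof.
move=> K0 e0; have K1 : 0 < K + 1 by rewrite ltr_wpDl.
have [n hn] := C_pow2 (divr_gt0 e0 K1); exists n.
have p0 : 0 < (2^-1 : C) ^+ n by rewrite exprn_gt0 // invr_gt0 ltr0n.
apply: (@le_lt_trans _ _ ((K + 1) * 2^-1 ^+ n)).
  by rewrite ler_wpM2r ?(ltW p0) // lerDl ler01.
by rewrite mulrC -ltr_pdivlMr.
Qed.

Lemma ler_pow2 (x y K : C) : 0 <= K ->
  (forall n, x <= y + K * (2^-1) ^+ n) -> x <= y.
Proof.
move=> K0 h; apply/ler_addgt0Pr => e e0.
have [n hn] := pow2_small_mul K0 e0.
by apply: le_trans (h n) _; rewrite lerD2l ltW.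
Qed.

Lemma pow2_ge0 n : 0 <= (2^-1 : C) ^+ n.
Proof. by rewrite exprn_ge0 // invr_ge0 ler0n. Qed.

Lemma ler_M1Bpow2 (r : C) n : 0 <= r -> r * (1 - (2^-1) ^+ n) <= r.
Proof. by move=> r0; rewrite mulrBr mulr1 gerBl mulr_ge0 ?pow2_ge0. Qed.

Lemma ler_pow2n m n : (m <= n)%N -> (2^-1 : C) ^+ n <= (2^-1) ^+ m.
Proof.
move=> mn; rewrite ler_wiXn2l // ?invr_ge0 ?ler0n //.
by rewrite invf_le1 ?ltr0n // ler1n.
Qed.

Lemma pow2_cvg0 (V : normedModType C) (s : nat -> V) (l : V) (K : C) : 0 <= K ->
  (forall n, `|l - s n| <= K * (2^-1) ^+ n) -> s n @[n --> \oo] --> l.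
Proof.
move=> K0 hs; apply/cvgrPdist_lt => e e0.
have [n hn] := pow2_small_mul K0 e0.
exists n => // m /= nm; apply: le_lt_trans (hs m) _.
by apply: le_lt_trans hn; rewrite ler_wpM2l // ler_pow2n.
Qed.

Lemma complete_geometric (V : completeNormedModType C) : @geometric_complete C V.
Proof.
move=> s k hs.
have k0 : 0 <= k.
  by have := le_trans (normr_ge0 _) (hs 0%N); rewrite expr0 mulr1.
have hm n m : `|s (n + m)%N - s n| <= 2 * k * (2^-1) ^+ n.
  (* The factor [1 - (2^-1) ^+ m] is the exact value of the partial geometric sum; without it the
     induction on [m] does not close. *)
  suff h : `|s (n + m)%N - s n| <= 2 * k * (2^-1) ^+ n * (1 - (2^-1) ^+ m).
    by apply: le_trans h (ler_M1Bpow2 _ _); rewrite !mulr_ge0 ?pow2_ge0.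
  elim: m => [|m IH]; first by rewrite addn0 subrr normr0 expr0 subrr mulr0.
  rewrite addnS -(subrK (s (n + m)%N) (s _.+1)) -addrA.
  apply: le_trans (ler_normD _ _) _.
  apply: le_trans (lerD (hs _) IH) _.
  rewrite exprD exprS le_eqVlt; apply/orP; left; apply/eqP.
  have two : (2 : C) * 2^-1 = 1 by rewrite mulfV // pnatr_eq0.
  set u := 2^-1 ^+ n; set v := 2^-1 ^+ m.
  rewrite [RHS]mulrBr mulrBr.
  have -> : 2 * k * u * (2^-1 * v) = k * u * v * (2 * 2^-1) by ring.
  by rewrite two; ring.
have cs : cvg (s n @[n --> \oo]).
  apply/cauchy_cvgP/cauchy_exP => e e0.
  have [n hn] : exists n, 2 * k * (2^-1) ^+ n < e.
    by apply: pow2_small_mul; rewrite ?mulr_ge0.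
  exists (s n), n => // m /= nm.
  rewrite -ball_normE /= distrC -(subnKC nm).
  by apply: le_lt_trans hn; exact: hm.
have [l hl] : exists l : V, s n @[n --> \oo] --> l by exists (lim (s n @[n --> \oo])).
exists l, (2 * k) => n; apply/ler_addgt0Pr => e e0.
move/cvgrPdist_lt: hl => /(_ e e0) [N _ hN].
have := hN (n + N)%N (leq_addl _ _); rewrite /= => hnN.
rewrite -(subrK (s (n + N)%N) l) -addrA [leRHS]addrC.
apply: le_trans (ler_normD _ _) (lerD (ltW hnN) _).
exact: hm.
Qed.

Section Contraction.
Variables (V : normedModType C).
Hypothesis V_complete : @geometric_complete C V.

(** The contraction is assumed only on a ball. Since [f 0] lies in the ball of half the radius and
    the ratio is [2^-1], the iterates satisfy [|s n| <= r (1 - 2^-n)] and never leave it. *)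
Lemma contraction_fixpoint (f : V -> V) (r : C) : `|f 0| <= r * 2^-1 ->
  (forall x y, `|x| <= r -> `|y| <= r -> `|f x - f y| <= 2^-1 * `|x - y|) ->
  exists2 x, `|x| <= r & f x = x.
Proof.
move=> f0 hf; pose s n := iter n f 0.
have h2 : (2^-1 : C) + 2^-1 = 1.
  by rewrite [RHS]splitr !mul1r.
have h0 : 0 <= (2^-1 : C) by rewrite invr_ge0 ler0n.
have r0 : 0 <= r.
  have : 0 <= r * 2^-1 := le_trans (normr_ge0 _) f0.
  by rewrite pmulr_lge0 // invr_gt0 ltr0n.
have hs n : `|s n| <= r * (1 - (2^-1) ^+ n) /\
    `|s n.+1 - s n| <= r * 2^-1 * (2^-1) ^+ n.
  elim: n => [|n [IH1 IH2]].
    by rewrite /= expr0 subrr mulr0 mulr1 normr0 subr0.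
  have sr m := ler_M1Bpow2 m r0.
  have h1 : `|s n.+1| <= r * (1 - 2^-1 ^+ n.+1).
    rewrite -(subrK (s n) (s n.+1)); apply: le_trans (ler_normD _ _) _.
    apply: le_trans (lerD IH2 IH1) _; rewrite -mulrA -mulrDr exprS.
    rewrite ler_wpM2l // -[X in 2^-1 * X + _]mul1r.
    set u := 2^-1 ^+ n; rewrite le_eqVlt; apply/orP; left; apply/eqP.
    by field.
  split=> //; rewrite exprS mulrCA.
  by apply: le_trans (hf _ _ (le_trans h1 (sr _)) (le_trans IH1 (sr _))) _; rewrite ler_wpM2l.
have [l [K hl]] := V_complete (fun n => (hs n).2).
have K0 : 0 <= K by have := le_trans (normr_ge0 _) (hl 0%N); rewrite expr0 mulr1.
have lr : `|l| <= r.
  apply: (ler_pow2 K0) => n; rewrite -(subrK (s n) l) [leRHS]addrC.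
  apply: le_trans (ler_normD _ _) (lerD (hl n) _).
  exact: le_trans (hs n).1 (ler_M1Bpow2 _ _).
exists l => //; apply/eqP; rewrite -subr_eq0 -normr_le0.
apply: (@ler_pow2 _ _ (2 * K)); first by rewrite mulr_ge0.
move=> n; rewrite add0r.
have -> : f l - l = (f l - f (s n)) + (s n.+1 - l).
  by rewrite addrA subrK.
apply: le_trans (ler_normD _ _) _.
have sn : `|s n| <= r.
  exact: le_trans (hs n).1 (ler_M1Bpow2 _ _).
rewrite -mulrA [2 * _]mulrDl !mul1r; apply: lerD.
  apply: le_trans (hf _ _ lr sn) _.
  apply: le_trans (hl n); rewrite -[leRHS]mul1r ler_wpM2r //.
  by rewrite invf_le1 ?ltr0n // ler1n.
rewrite distrC; apply: le_trans (hl _) _.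
by rewrite ler_wpM2l ?mulr_ge0 // ler_pow2n.
Qed.

End Contraction.
End GeometricSequences.

Section OperatorBounds.
Variables (C : numClosedFieldType) (A : vonNeumannAlgebra C).
Hypothesis C_pow2 : pow2_small C.

(** Boundedness is hidden in the bicommutant condition: a commutant consists of bounded operators by
    definition. *)
Lemma vN_op_bounded (x : A) : bounded_op (vN_op x).
Proof.
have : commutant (commutant (range (@vN_op C A))) (vN_op x).
  by rewrite -vN_bicommutant; exists x.
by case.
Qed.

Lemma vN_op_linear (x : A) : linear (vN_op x).
Proof. by have [] := vN_op_bounded x. Qed.

Lemma vN_op0 (x : A) : vN_op x 0 = 0.
Proof.
have := vN_op_linear x (-1) 0 0.
by rewrite scaler0 addr0 scaleN1r addNr.
Qed.

Lemma vN_opB (x : A) h k : vN_op x (h - k) = vN_op x h - vN_op x k.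
Proof. by rewrite -scaleN1r addrC vN_op_linear scaleN1r addrC. Qed.

Lemma vN_opBl (x y : A) h : vN_op (x - y) h = vN_op x h - vN_op y h.
Proof. by rewrite -scaleN1r addrC vN_opP scaleN1r addrC. Qed.

Lemma vN_op0l h : vN_op (0 : A) h = 0.
Proof. by rewrite -(subrr 1) vN_opBl subrr. Qed.

(** The operator norm enters only through its upper bounds, which avoids suprema in [C]. *)
Definition opbound (x : A) (k : C) : Prop :=
  0 <= k /\ forall h, `|vN_op x h| <= k * `|h|.

Lemma opbound_ex (x : A) : exists k, opbound x k.
Proof.
(* On a zero space the constant of [bounded_op] can be arbitrary, so its modulus is taken. *)
have [_ [k hk]] := vN_op_bounded x; exists `|k|; split=> // h.
apply: le_trans (hk h) _; rewrite -[`|h| in leRHS]normr_id -normrM.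
by rewrite ger0_norm // (le_trans (normr_ge0 _) (hk h)).
Qed.

Lemma opbound_le (x : A) k l : opbound x k -> k <= l -> opbound x l.
Proof.
move=> [k0 hk] kl; split; first exact: le_trans kl.
by move=> h; apply: le_trans (hk h) _; rewrite ler_wpM2r.
Qed.

Lemma opbound0 : opbound 0 0.
Proof. by split=> // h; rewrite vN_op0l normr0 mul0r. Qed.

Lemma opbound1 : opbound 1 1.
Proof. by split=> // h; rewrite vN_op1 mul1r. Qed.

Lemma opboundP c (x y : A) k l : opbound x k -> opbound y l ->
  opbound (c *: x + y) (`|c| * k + l).
Proof.
move=> [k0 hk] [l0 hl]; split; first by rewrite addr_ge0 // mulr_ge0.
move=> h; rewrite vN_opP mulrDl; apply: le_trans (ler_normD _ _) _.
by rewrite lerD // normrZ -mulrA ler_wpM2l.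
Qed.

Lemma opboundZ c (x : A) k : opbound x k -> opbound (c *: x) (`|c| * k).
Proof. by move=> h; have := opboundP c h opbound0; rewrite !addr0. Qed.

Lemma opboundD (x y : A) k l : opbound x k -> opbound y l -> opbound (x + y) (k + l).
Proof. by move=> h1 h2; have := opboundP 1 h1 h2; rewrite scale1r normr1 mul1r. Qed.

Lemma opboundN (x : A) k : opbound x k -> opbound (- x) k.
Proof. by move=> h; have := opboundZ (-1) h; rewrite scaleN1r normrN1 mul1r. Qed.

Lemma opboundB (x y : A) k l : opbound x k -> opbound y l -> opbound (x - y) (k + l).
Proof. by move=> h1 h2; apply: opboundD => //; exact: opboundN. Qed.

Lemma opboundM (x y : A) k l : opbound x k -> opbound y l -> opbound (x * y) (k * l).
Proof.
move=> [k0 hk] [l0 hl]; split; first exact: mulr_ge0.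
move=> h; rewrite vN_opM -mulrA; apply: le_trans (hk _) _.
by rewrite ler_wpM2l.
Qed.

Lemma opbound_alg (c : C) : opbound c%:A `|c|.
Proof. by have := opboundZ c opbound1; rewrite mulr1. Qed.

Lemma opboundX (x : A) k n : opbound x k -> opbound (x ^+ n) (k ^+ n).
Proof.
move=> h; elim: n => [|n IH]; first by rewrite !expr0; exact: opbound1.
by rewrite !exprS; exact: opboundM.
Qed.

Definition is_inv (x y : A) := x * y = 1 /\ y * x = 1.

Lemma is_inv_uniq (x y y' : A) : is_inv x y -> is_inv x y' -> y = y'.
Proof. by move=> [_ h] [h' _]; rewrite -[y]mulr1 -h' mulrA h mul1r. Qed.

Lemma inv_sub_geometric (t r : A) n : is_inv (1 - t) r ->
  r - \sum_(i < n) t ^+ i = t ^+ n * r.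
Proof.
move=> hr; elim: n => [|n IH]; first by rewrite big_ord0 subr0 expr0 mul1r.
rewrite big_ord_recr /= opprD addrA IH exprSr -mulrA -[t ^+ n in X in _ - X]mulr1.
rewrite -mulrBr; congr (_ * _); apply/eqP.
by rewrite subr_eq -hr.1 mulrBl mul1r addrC subrK.
Qed.

(* The inverse of [1 - t] computed on the Hilbert space commutes with the
   commutant of the algebra, hence lies in the bicommutant. *)
Lemma neumann_inv (t : A) : opbound t 2^-1 ->
  exists2 r, is_inv (1 - t) r & opbound r 2.
Proof.
move=> [_ ht].
have H2 : (0 : C) < 2^-1 by rewrite invr_gt0 ltr0n.
have sol k : exists2 x, `|x| <= 2 * `|k| & k + vN_op t x = x.
  apply: (@contraction_fixpoint _ C_pow2 _ (@complete_geometric _ C_pow2 (vN_space A))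
      (fun x => k + vN_op t x)).
    by rewrite vN_op0 addr0 mulrAC mulfV ?mul1r // pnatr_eq0.
  by move=> x y _ _; rewrite opprD addrACA subrr add0r -vN_opB.
have uniq k x y : k + vN_op t x = x -> k + vN_op t y = y -> x = y.
  move=> hx hy; apply/eqP; rewrite -subr_eq0 -normr_le0.
  have : `|x - y| <= 2^-1 * `|x - y|.
    by rewrite -{1}hx -{1}hy opprD addrACA subrr add0r -vN_opB.
  by rewrite mulrC {1}(splitr `|x - y|) gerDl pmulr_lle0.
pose f k := projT1 (cid2 (sol k)).
have fb k : `|f k| <= 2 * `|k| by rewrite /f; case: cid2.
have fE k : k + vN_op t (f k) = f k by rewrite /f; case: cid2.
have bf : bounded_op f.
  split; last by exists 2.
  move=> c x y; apply: (uniq (c *: x + y)); first exact: fE.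
  rewrite vN_op_linear addrACA -scalerDr !fE //.
have : commutant (commutant (range (@vN_op C A))) f.
  split=> // S [[Slin _] cS]; apply/funext => k /=.
  apply: (uniq (S k)); first exact: fE.
  have St : vN_op t (S (f k)) = S (vN_op t (f k)).
    have /(congr1 (fun g => g (f k))) := cS (vN_op t) (ex_intro2 _ _ t I erefl).
    by move=> /= ->.
  rewrite St -[X in X + _]scale1r -Slin scale1r fE //.
rewrite -vN_bicommutant => -[r _ rf].
exists r; last by split=> // h; rewrite rf.
have e1 : (1 - t) * r = 1.
  apply: (@vN_op_inj _ A); apply/funext => h.
  by rewrite vN_opM vN_opBl !vN_op1 rf -{1}(fE h) addrK.
split=> //; apply: (@vN_op_inj _ A); apply/funext => h.
rewrite vN_opM vN_op1 rf; apply: (uniq ((vN_op (1 - t)) h)); first exact: fE.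
by rewrite vN_opBl vN_op1 subrK.
Qed.

(** Operator norm closure, written out because [vN_alg] is a bare algebra without a topology. *)
Definition closure_of (S : set A) : set A :=
  [set x | forall e : C, 0 < e -> exists2 y, S y & opbound (x - y) e].

Lemma closure_of_sub S : S `<=` closure_of S.
Proof.
move=> x Sx e e0; exists x => //; rewrite subrr.
by apply: opbound_le opbound0 _; exact: ltW.
Qed.

Lemma closure_of_idem S : closure_of (closure_of S) `<=` closure_of S.
Proof.
move=> x hx e e0; have e2 : 0 < e / 2 by rewrite divr_gt0 // ltr0n.
have [y hy yb] := hx _ e2; have [z hz zb] := hy _ e2; exists z => //.
by rewrite -(subrK y x) -addrA (splitr e); apply: opboundD.
Qed.

Lemma closure_of_lin (S S' S'' : set A) c x y :
  (forall x y, S x -> S' y -> S'' (c *: x + y)) ->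
  closure_of S x -> closure_of S' y -> closure_of S'' (c *: x + y).
Proof.
move=> SS hx hy e e0; have e2 : 0 < e / 2 by rewrite divr_gt0 // ltr0n.
have c1 : 0 < `|c| + 1 by rewrite ltr_wpDl.
have [x' Sx bx] := hx (e / 2 / (`|c| + 1)) (divr_gt0 e2 c1).
have [y' Sy b_y] := hy _ e2.
exists (c *: x' + y'); first exact: SS.
rewrite opprD addrACA -scalerBr (splitr e).
apply: opbound_le (opboundP c bx b_y) _; rewrite lerD2r.
rewrite mulrCA -[leRHS]mulr1 ler_wpM2l ?(ltW e2) //.
by rewrite ler_pdivrMr // mul1r lerDl ler01.
Qed.

Lemma closure_of_mul (S S' S'' : set A) x y :
  (forall x y, S x -> S' y -> S'' (x * y)) ->
  closure_of S x -> closure_of S' y -> closure_of S'' (x * y).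
Proof.
move=> SS hx hy e e0; have e2 : 0 < e / 2 by rewrite divr_gt0 // ltr0n.
have [k [k0 hk]] := opbound_ex y.
have k1 : 0 < k + 1 by rewrite ltr_wpDl.
(* The approximation [x'] is fixed first, since the tolerance for [y'] depends on a bound of
   [x']. *)
have [x' Sx bx] := hx (e / 2 / (k + 1)) (divr_gt0 e2 k1).
have [l [l0 hl]] := opbound_ex x'.
have l1 : 0 < l + 1 by rewrite ltr_wpDl.
have [y' Sy b_y] := hy (e / 2 / (l + 1)) (divr_gt0 e2 l1).
exists (x' * y'); first exact: SS.
have -> : x * y - x' * y' = (x - x') * y + x' * (y - y').
  by rewrite mulrBl mulrBr addrA subrK.
rewrite (splitr e); apply: opboundD.
  apply: opbound_le (opboundM bx (conj k0 hk)) _.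
  rewrite -mulrA -[leRHS]mulr1 ler_wpM2l ?(ltW e2) //.
  by rewrite mulrC ler_pdivrMr // mul1r lerDl ler01.
apply: opbound_le (opboundM (conj l0 hl) b_y) _.
rewrite mulrCA -[leRHS]mulr1 ler_wpM2l ?(ltW e2) //.
by rewrite ler_pdivrMr // mul1r lerDl ler01.
Qed.

(** The partial sums of [y (1 + t + t^2 + ...)] lie in [S]. The prefix [y] allows [S] to be a set of
    words that is not closed under products. *)
Lemma neumann_closure (S : set A) (t r y : A) : opbound t 2^-1 -> is_inv (1 - t) r ->
  S 0 -> (forall x z, S x -> S z -> S (x + z)) -> (forall k, S (y * t ^+ k)) ->
  closure_of S (y * r).
Proof.
move=> ht hr S0 SD St e e0.
have [k [k0 hk]] := opbound_ex y; have [l [l0 hl]] := opbound_ex r.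
have [n hn] := pow2_small_mul C_pow2 (mulr_ge0 k0 l0) e0.
exists (\sum_(i < n) y * t ^+ i).
  by elim/big_ind: _ => // i _; exact: St.
have -> : y * r - \sum_(i < n) y * t ^+ i = y * (t ^+ n * r).
  by rewrite -mulr_sumr -mulrBr inv_sub_geometric.
apply: opbound_le (opboundM (conj k0 hk) (opboundM (opboundX n ht) (conj l0 hl))) _.
by rewrite mulrCA mulrC (ltW hn).
Qed.

Variable phi : {scalar A}.
Hypothesis phi_state : is_state phi.

Lemma state_opbound x k : opbound x k -> `|phi x| <= k.
Proof. by case=> _; exact: state_norm_le1. Qed.

Lemma closure_of_eq0 (S : set A) (f : A -> C) (K : C) : 0 <= K ->
  (forall x y, f (x - y) = f x - f y) ->
  (forall x k, opbound x k -> `|f x| <= K * k) ->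
  (forall x, S x -> f x = 0) -> forall x, closure_of S x -> f x = 0.
Proof.
move=> K0 fB fb fS x hx; apply/eqP; rewrite -normr_le0.
apply/ler_addgt0Pr => e e0; rewrite add0r.
have K1 : 0 < K + 1 by rewrite ltr_wpDl.
have [y Sy hy] := hx _ (divr_gt0 e0 K1).
have -> : f x = f (x - y) by rewrite fB (fS y Sy) subr0.
apply: le_trans (fb _ _ hy) _; rewrite mulrCA -[leRHS]mulr1 ler_wpM2l ?(ltW e0) //.
by rewrite ler_pdivrMr // mul1r lerDl ler01.
Qed.

(** Factors are kept on both sides so that the same limit serves [Psi], where they are 1, and both
    nested sums of [Hseries]. *)
Lemma neumann_series (t r y y' : A) : opbound t 2^-1 -> is_inv (1 - t) r ->
  \sum_(0 <= n < N) phi (y * t ^+ n * y') @[N --> \oo] --> phi (y * r * y').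
Proof.
move=> ht hr.
have [k kb] := opbound_ex y; have [l lb] := opbound_ex (r * y').
apply: (@pow2_cvg0 _ C_pow2 _ _ _ (k * l)); first by rewrite mulr_ge0 ?kb.1 ?lb.1.
move=> N; rewrite big_mkord -linear_sum -linearB.
have -> : y * r * y' - \sum_(i < N) y * t ^+ i * y' = y * (t ^+ N * (r * y')).
  by rewrite -mulr_suml -mulrBl -mulr_sumr -mulrBr inv_sub_geometric // !mulrA.
apply: (state_opbound); apply: opbound_le (opboundM kb (opboundM (opboundX N ht) lb)) _.
by rewrite mulrCA mulrC.
Qed.

End OperatorBounds.

(** * Moments of a product of bi-free pairs *)

Section BifreeResolvents.
Variables (C : numClosedFieldType) (A : vonNeumannAlgebra C).
Hypothesis C_pow2 : pow2_small C.

Lemma is_invP (x y : A) : is_inv (1 - x) y -> y * x = y - 1 /\ x * y = y - 1.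
Proof.
move=> [h1 h2]; split.
  by rewrite -h2 mulrBr mulr1 opprB addrC subrK.
by rewrite -h1 mulrBl mul1r opprB addrC subrK.
Qed.

(* Haagerup's factorization
   [R1 (1 - rho a1 a2) R2 = p (1 - u1 u2 / (z p))], where [Ri = p + ui]. *)
Lemma product_resolvent (a1 a2 R1 R2 M : A) (x1 x2 z p : C) :
  z != 0 -> p != 0 -> p = 1 + z ->
  is_inv (1 - x1 *: a1) R1 -> is_inv (1 - x2 *: a2) R2 ->
  is_inv (1 - (z * p)^-1 *: ((R1 - p%:A) * (R2 - p%:A))) M ->
  is_inv (1 - (x1 * x2 * p / z) *: (a1 * a2)) (p^-1 *: (R2 * M * R1)).
Proof.
move=> z0 p0 pz I1 I2 IM; set rho := _ / z; set N := 1 - (z * p)^-1 *: _ in IM.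
have [r1 _] := is_invP I1; have [_ r2] := is_invP I2.
have key : R1 * (1 - rho *: (a1 * a2)) * R2 = p *: N.
  have e : R1 * (rho *: (a1 * a2)) * R2 = (p / z) *: ((R1 - 1) * (R2 - 1)).
    rewrite -r1 -r2 -!(scalerAl, scalerAr) !scalerA !mulrA /rho.
    by congr (_ *: _); ring.
  rewrite mulrBr mulr1 mulrBl e /N.
  set u1 := R1 - p%:A; set u2 := R2 - p%:A.
  have prodE (c : C) (u v : A) :
      (c%:A + u) * (c%:A + v) = (c * c)%:A + c *: (v + u) + u * v.
    by rewrite mulrDl !mulrDr !mulr_algl !mulr_algr scalerA scalerDr !addrA.
  have -> : R1 * R2 = (p%:A + u1) * (p%:A + u2) by rewrite [p%:A + u1]addrC [p%:A + u2]addrC !subrK.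
  have -> : R1 - 1 = z%:A + u1.
    by rewrite /u1 pz scalerDl scale1r opprD [RHS]addrC addrA subrK.
  have -> : R2 - 1 = z%:A + u2.
    by rewrite /u2 pz scalerDl scale1r opprD [RHS]addrC addrA subrK.
  rewrite !prodE; clearbody u1 u2.
  rewrite !(scalerDr, scalerN) !scalerA.
  have -> : p / z * z = p by rewrite divfK.
  have -> : p / z * (z * z) = p * z by rewrite mulrA divfK.
  have -> : p * (z * p)^-1 = z^-1 by rewrite invfM mulrCA divff // mulr1.
  rewrite -!scalerDr; set s := p *: (u2 + u1); set t := u1 * u2.
  rewrite opprD addrACA; congr (_ + _).
    rewrite opprD addrACA subrr addr0 -scalerBl; congr (_ *: _).
    by rewrite -mulrBr {2}pz addrK mulr1.
  rewrite -{1}[t]scale1r -scalerBl -scaleNr; congr (_ *: _).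
  by rewrite -[1](divff z0) -mulrBl {1}pz opprD addrCA subrr addr0 mulN1r.
have [n1 n2] := IM; have [i1 i1'] := I1; have [i2 i2'] := I2.
have e1 : 1 - rho *: (a1 * a2) = p *: ((1 - x1 *: a1) * N * (1 - x2 *: a2)).
  by rewrite [RHS]scalerAl [in RHS]scalerAr -key !mulrA i1 mul1r -mulrA i2' mulr1.
split; rewrite e1 -!(scalerAl, scalerAr) scalerA.
  rewrite mulfV // scale1r !mulrA -[_ * R2]mulrA -[_ * (_ * R2)]mulrA i2 mulr1.
  by rewrite -[_ * N * M]mulrA n1 mulr1.
rewrite mulVf // scale1r !mulrA -[_ * R1 * _]mulrA i1' mulr1.
by rewrite -[_ * M * N]mulrA n2 mulr1.
Qed.

Variable phi : {scalar A}.
Hypothesis phi_state : is_state phi.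

(** Both sides are bounded and linear in [x]. The shape with [x] between fixed factors is meant for
    replacing the factors of a product by limits, one after the other. *)
Lemma closure_of_phi_eq (S : set A) (c : C) (l r l' r' : A) :
  (forall x, S x -> phi (l * x * r) = c * phi (l' * x * r')) ->
  forall x, closure_of S x -> phi (l * x * r) = c * phi (l' * x * r').
Proof.
move=> hS x hx; apply/eqP; rewrite -subr_eq0; apply/eqP.
have [kl bl] := opbound_ex l; have [kr br] := opbound_ex r.
have [kl' bl'] := opbound_ex l'; have [kr' br'] := opbound_ex r'.
apply: (closure_of_eq0 (f := fun x => phi (l * x * r) - c * phi (l' * x * r'))
  (K := kl * kr + `|c| * (kl' * kr')) _ _ _ _ hx).
- by rewrite addr_ge0 ?mulr_ge0 // ?bl.1 ?br.1 ?bl'.1 ?br'.1.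
- by move=> y z; rewrite !(mulrBr, mulrBl) !linearB /=; ring.
- move=> y k hy; apply: le_trans (ler_normB _ _) _; rewrite mulrDl normrM.
  apply: lerD.
    have := state_opbound phi_state (opboundM (opboundM bl hy) br).
    by rewrite mulrAC.
  rewrite -[leRHS]mulrA ler_wpM2l //.
  have := state_opbound phi_state (opboundM (opboundM bl' hy) br').
  by rewrite mulrAC.
- by move=> y /hS ->; rewrite subrr.
Qed.

Lemma closure_of_phi_eq0 (S : set A) (l r : A) :
  (forall x, S x -> phi (l * x * r) = 0) ->
  forall x, closure_of S x -> phi (l * x * r) = 0.
Proof.
move=> hS x hx; rewrite (@closure_of_phi_eq S 0 l r 0 0 _ x hx) ?mul0r //.
by move=> y /hS ->; rewrite mul0r.
Qed.

Lemma closure_of_phi3_eq0 (S1 S2 S3 : set A) :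
  (forall x y z, S1 x -> S2 y -> S3 z -> phi (x * y * z) = 0) ->
  forall x y z, closure_of S1 x -> closure_of S2 y -> closure_of S3 z ->
  phi (x * y * z) = 0.
Proof.
move=> h x y z hx hy hz.
rewrite -[_ * z]mulr1; apply: closure_of_phi_eq0 hz => {}z hz.
rewrite mulr1; apply: closure_of_phi_eq0 hy => {}y hy.
rewrite -mulrA -[x]mul1r; apply: closure_of_phi_eq0 hx => {}x hx.
by rewrite mul1r mulrA h.
Qed.

Definition poly_closure (x : A) : set A := closure_of (range (horner_alg x)).

Definition word_closure (a : bool -> A) i : set A :=
  closure_of (centered_words phi a i).

(** An approximating polynomial has moment at most [e / 2] because [phi u = 0]; subtracting this
    moment centers it and costs only another [e / 2]. *)
Lemma poly_closure_centered (a u : A) : poly_closure a u -> phi u = 0 ->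
  closure_of [set x | exists2 p, x = horner_alg a p & phi x = 0] u.
Proof.
move=> hu u0 e e0; have e2 : 0 < e / 2 by rewrite divr_gt0 // ltr0n.
have [_ [p _ <-] hp] := hu _ e2.
have hphi : `|phi (horner_alg a p)| <= e / 2.
  by rewrite -normrN -[- _]add0r -u0 -linearB; exact: (state_opbound phi_state).
exists (horner_alg a p - (phi (horner_alg a p))%:A).
  exists (p - (phi (horner_alg a p))%:P); first by rewrite rmorphB /= horner_algC.
  by rewrite linearB linearZ /= (state1 phi_state) mulr1 subrr.
rewrite opprB addrCA [_%:A + _]addrC (splitr e); apply: opboundD => //.
exact: opbound_le (opbound_alg _ _) _.
Qed.

Lemma word_closure_mul (a : bool -> A) i x u : word_closure a i x ->
  poly_closure (a i) u -> phi u = 0 -> word_closure a (~~ i) (x * u).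
Proof.
move=> hx hu u0; apply: closure_of_mul hx (poly_closure_centered hu u0).
by move=> y _ hy [p ->]; exact: cw_mul.
Qed.

Lemma word_closure_lin (a : bool -> A) i c x y : word_closure a i x ->
  word_closure a i y -> word_closure a i (c *: x + y).
Proof. by apply: closure_of_lin => *; exact: cw_lin. Qed.

Lemma word_closure1 (a : bool -> A) i : word_closure a i 1.
Proof. by apply: closure_of_sub; exact: cw1. Qed.

Variables (a b : bool -> A).
Hypothesis ab_bifree : bifree phi (a false) (b false) (a true) (b true).

(** Density: each of the four factors is in turn replaced by a limit, the others being held
    fixed. *)
Lemma bifree_word_closure i x y u v :
  word_closure a i x -> word_closure b i y ->
  poly_closure (a i) u -> phi u = 0 -> poly_closure (b i) v -> phi v = 0 ->
  [/\ phi (x * u * y) = 0, phi (x * (y * v)) = 0 &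
      phi (x * u * (y * v)) = phi (u * v) * phi (x * y)].
Proof.
move=> hx hy hu u0 hv v0.
have {u0}hu := poly_closure_centered hu u0.
have {v0}hv := poly_closure_centered hv v0.
have [B1 B2 B3] : [/\ forall x y p, centered_words phi a i x ->
    centered_words phi b i y -> phi (horner_alg (a i) p) = 0 ->
    phi (x * horner_alg (a i) p * y) = 0,
  forall x y p, centered_words phi a i x -> centered_words phi b i y ->
    phi (horner_alg (b i) p) = 0 -> phi (x * (y * horner_alg (b i) p)) = 0 &
  forall x y p r, centered_words phi a i x -> centered_words phi b i y ->
    phi (horner_alg (a i) p) = 0 -> phi (horner_alg (b i) r) = 0 ->
    phi (x * horner_alg (a i) p * (y * horner_alg (b i) r)) =
    phi (horner_alg (a i) p * horner_alg (b i) r) * phi (x * y)].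
  (* The zero polynomial is centered and fills the slot of the letter that is absent from the first
     two identities. *)
  have z0 c : phi (horner_alg (c : A) 0) = 0 by rewrite rmorph0 linear0.
  split=> [x' y' p cx cy p0|x' y' p cx cy p0|x' y' p r cx cy p0 r0].
  - by have [] := bifree_words ab_bifree cx cy p0 (z0 _).
  - by have [] := bifree_words ab_bifree cx cy (z0 _) p0.
  - by have [] := bifree_words ab_bifree cx cy p0 r0.
split.
- by apply: closure_of_phi3_eq0 hx hu hy => {}x {}u {}y hx [p -> p0] hy; exact: B1.
- rewrite mulrA; apply: closure_of_phi3_eq0 hx hy hv => {}x {}y {}v hx hy [p -> p0].
  by rewrite -mulrA; exact: B2.
(* The limit is taken in [v] first, then in [u], [y] and [x]; each rewriting isolates one factor in
   the middle of a product. *)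
- have E4 x' y' p : centered_words phi a i x' -> centered_words phi b i y' ->
      phi (horner_alg (a i) p) = 0 ->
      phi (x' * horner_alg (a i) p * (y' * v)) =
      phi (horner_alg (a i) p * v) * phi (x' * y').
    move=> cx cy p0; set u' := horner_alg _ _.
    rewrite mulrC mulrA -[u' * v]mulr1 -[_ * v]mulr1.
    apply: closure_of_phi_eq hv => _ [r -> r0].
    by rewrite !mulr1 mulrC -mulrA B3.
  have E3 x' y' : centered_words phi a i x' -> centered_words phi b i y' ->
      phi (x' * u * (y' * v)) = phi (u * v) * phi (x' * y').
    move=> cx cy; rewrite mulrC -[x' * u * _]mulrA mulrA -[u * v]mul1r [1 * (_ * _)]mulrA.
    rewrite mulrA -[x' * u * _ * _]mulrA.
    apply: closure_of_phi_eq hu => _ [p -> p0].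
    by rewrite mul1r mulrC E4.
  have E2 x' : centered_words phi a i x' ->
      phi (x' * u * (y * v)) = phi (u * v) * phi (x' * y).
    move=> cx; rewrite mulrA -[x' * y]mulr1.
    apply: closure_of_phi_eq hy => y' cy.
    by rewrite -mulrA mulr1 E3.
  rewrite -mulrA -[x * (u * _)]mul1r -[x * y]mul1r !(mulrA 1).
  apply: closure_of_phi_eq hx => x' cx.
  by rewrite !mul1r mulrA E2.
Qed.

Lemma word_closure_resolvent (c : bool -> A) (u1 u2 M y : A) (d : C) :
  (forall x, word_closure c false x -> word_closure c false (x * (u1 * u2))) ->
  opbound (d *: (u1 * u2)) 2^-1 -> is_inv (1 - d *: (u1 * u2)) M ->
  word_closure c false y -> word_closure c false (y * M).
Proof.
move=> hc hb hM hy; apply: closure_of_idem.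
have w0 : word_closure c false 0.
  have := word_closure_lin (-1) (word_closure1 c false) (word_closure1 c false).
  by rewrite scaleN1r addNr.
apply: (neumann_closure C_pow2 hb hM) => //.
  by move=> x z hx hz; have := word_closure_lin 1 hx hz; rewrite scale1r.
elim=> [|k IH]; first by rewrite expr0 mulr1.
rewrite exprSr mulrA -scalerAr -[_ *: _]addr0; apply: word_closure_lin => //.
exact: hc.
Qed.

(** No double series is summed. The element [x] satisfies [x = p + u_2 + c x u_1 u_2], and [y] the
    analogous equation, so [phi (x * y)] satisfies a scalar affine equation whose slope is
    [c d kappa_1 kappa_2]. The last factors of [X] and [Y] contribute [p q + kappa_1]. *)
Lemma bifree_geometric (p q c d : C) (u v : bool -> A) (M N : A) :
  (forall i, poly_closure (a i) (u i)) -> (forall i, phi (u i) = 0) ->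
  (forall i, poly_closure (b i) (v i)) -> (forall i, phi (v i) = 0) ->
  opbound (c *: (u false * u true)) 2^-1 ->
  opbound (d *: (v false * v true)) 2^-1 ->
  is_inv (1 - c *: (u false * u true)) M ->
  is_inv (1 - d *: (v false * v true)) N ->
  let X := (p%:A + u true) * M * (p%:A + u false) in
  let Y := (q%:A + v true) * N * (q%:A + v false) in
  let kappa i := phi (u i * v i) in
  [/\ phi X = p * p, phi Y = q * q &
    phi (X * Y) * (1 - c * d * (kappa false * kappa true)) =
    (p * q + kappa false) * (p * q + kappa true)].
Proof.
move=> hu u0 hv v0 bM bN hM hN X Y kappa.
pose x := (p%:A + u true) * M; pose y := (q%:A + v true) * N.
have wu w : word_closure a false w -> word_closure a false (w * (u false * u true)).
  move=> hw; rewrite mulrA.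
  by have := word_closure_mul (word_closure_mul hw (hu false) (u0 false)) (hu true) (u0 true).
have wv w : word_closure b false w -> word_closure b false (w * (v false * v true)).
  move=> hw; rewrite mulrA.
  by have := word_closure_mul (word_closure_mul hw (hv false) (v0 false)) (hv true) (v0 true).
have a1 i := word_closure1 a i.
have b1 i := word_closure1 b i.
have wx : word_closure a false x.
  apply: word_closure_resolvent wu bM hM _; apply: word_closure_lin => //.
  by have := word_closure_mul (a1 true) (hu true) (u0 true); rewrite mul1r.
have wy : word_closure b false y.
  apply: word_closure_resolvent wv bN hN _; apply: word_closure_lin => //.
  by have := word_closure_mul (b1 true) (hv true) (v0 true); rewrite mul1r.
have wxu : word_closure a true (x * u false) := word_closure_mul wx (hu false) (u0 false).
have wyv : word_closure b true (y * v false) := word_closure_mul wy (hv false) (v0 false).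
have xE : x = p%:A + u true + c *: (x * u false * u true).
  rewrite -[LHS](subrK (x * (c *: (u false * u true)))) -{1}[x]mulr1 -mulrBr.
  rewrite {1}/x -!mulrA hM.2 mulr1; congr (_ + _).
  by rewrite -!scalerAr !mulrA.
have yE : y = q%:A + v true + d *: (y * v false * v true).
  rewrite -[LHS](subrK (y * (d *: (v false * v true)))) -{1}[y]mulr1 -mulrBr.
  rewrite {1}/y -!mulrA hN.2 mulr1; congr (_ + _).
  by rewrite -!scalerAr !mulrA.
have word i s t : word_closure a i s -> word_closure b i t ->
    [/\ phi (s * u i * t) = 0, phi (s * (t * v i)) = 0 &
      phi (s * u i * (t * v i)) = kappa i * phi (s * t)].
  by move=> hs ht; have [] := bifree_word_closure hs ht (hu i) (u0 i) (hv i) (v0 i).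
have phi1 := state1 phi_state.
have [xuy xyv xuyv] := word _ _ _ wx wy.
have [xu _ _] := word _ _ _ wx (b1 false).
have [_ yv _] := word _ _ _ (a1 false) wy.
have [xuu _ xuuv] := word _ _ _ wxu (b1 true).
have [_ yvv uyvv] := word _ _ _ (a1 true) wyv.
have [_ _ xuuyvv] := word _ _ _ wxu wyv.
rewrite mulr1 in xu; rewrite mul1r in yv; rewrite mulr1 in xuu; rewrite mul1r in yvv.
rewrite mul1r mulr1 xu mulr0 in xuuv; rewrite !mul1r yv mulr0 in uyvv.
rewrite xuyv in xuuyvv.
have phix : phi x = p.
  rewrite xE !linearD !linearZ /= u0 phi1 xuu.
  by rewrite mulr0 !addr0 mulr1.
have phiy : phi y = q.
  rewrite yE !linearD !linearZ /= v0 phi1 yvv.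
  by rewrite mulr0 !addr0 mulr1.
split.
- rewrite /X -/x mulrDr linearD mulr_algr linearZ /= phix xu.
  by rewrite addr0.
- rewrite /Y -/y mulrDr linearD mulr_algr linearZ /= phiy yv.
  by rewrite addr0.
(* Of the nine products only three survive: the constants, the pair of last letters, and the two
   long words, which are peeled by two matching pairs of letters. *)
have G : phi (x * y) = p * q + kappa true + c * d * (kappa false * kappa true) * phi (x * y).
  rewrite {1}xE {1}yE.
  rewrite !(mulrDl, mulrDr) !(mulr_algl, mulr_algr) -![in LHS](scalerAl, scalerAr).
  rewrite ![in LHS](linearD, linearZ) /= phi1 u0 v0 yvv xuu xuuv uyvv xuuyvv -/(kappa true).
  by ring.
have -> : phi (X * Y) = (p * q + kappa false) * phi (x * y).
  rewrite /X /Y -/x -/y !(mulrDl, mulrDr) !(mulr_algl, mulr_algr) -![in LHS](scalerAl, scalerAr).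
  by rewrite ![in LHS](linearD, linearZ) /= xyv xuy xuyv; ring.
apply/eqP; rewrite -subr_eq0; set g := phi (x * y) in G *.
have -> : (p * q + kappa false) * g * (1 - c * d * (kappa false * kappa true)) -
    (p * q + kappa false) * (p * q + kappa true) = (p * q + kappa false) *
    (g - (p * q + kappa true + c * d * (kappa false * kappa true) * g)) by ring.
by rewrite -G subrr mulr0.
Qed.

(* Voiculescu's multiplicativity of the partial bi-free S-transform, solved for
   the two-variable moment series of the product. *)
Lemma bifree_product_resolvents (x y : bool -> C) (z w p q : C)
    (R Q : bool -> A) (L K : A) :
  z != 0 -> p != 0 -> p = 1 + z -> w != 0 -> q != 0 -> q = 1 + w ->
  (forall i, opbound (x i *: a i) 2^-1) -> (forall i, is_inv (1 - x i *: a i) (R i)) ->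
  (forall i, phi (R i) = p) ->
  (forall i, opbound (y i *: b i) 2^-1) -> (forall i, is_inv (1 - y i *: b i) (Q i)) ->
  (forall i, phi (Q i) = q) ->
  opbound ((z * p)^-1 *: ((R false - p%:A) * (R true - p%:A))) 2^-1 ->
  opbound ((w * q)^-1 *: ((Q false - q%:A) * (Q true - q%:A))) 2^-1 ->
  is_inv (1 - (x false * x true * p / z) *: (a false * a true)) L ->
  is_inv (1 - (y false * y true * q / w) *: (b false * b true)) K ->
  let kappa i := phi (R i * Q i) - p * q in
  [/\ phi L = p, phi K = q &
    phi (L * K) * (z * w * p * q - kappa false * kappa true) =
    z * w * phi (R false * Q false) * phi (R true * Q true)].
Proof.
move=> z0 p0 pz w0 q0 qw xb xR Rp yb yQ Qq bM bN hL hK kappa.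
have [M hM _] := neumann_inv C_pow2 bM; have [N hN _] := neumann_inv C_pow2 bN.
have LE := is_inv_uniq hL (product_resolvent z0 p0 pz (xR false) (xR true) hM).
have KE := is_inv_uniq hK (product_resolvent w0 q0 qw (yQ false) (yQ true) hN).
pose u i := R i - p%:A; pose v i := Q i - q%:A.
have phi1 := state1 phi_state.
have u0 i : phi (u i) = 0 by rewrite linearB linearZ /= Rp phi1 mulr1 subrr.
have v0 i : phi (v i) = 0 by rewrite linearB linearZ /= Qq phi1 mulr1 subrr.
have resolvent_poly (e : A) s (r : A) t : opbound (s *: e) 2^-1 ->
    is_inv (1 - s *: e) r -> poly_closure e (r - t%:A).
  move=> hb hr.
  have hr1 : poly_closure e r.
    rewrite -[r]mul1r; apply: (neumann_closure C_pow2 hb hr).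
    - by exists 0; rewrite ?rmorph0.
    - by move=> _ _ [f _ <-] [g _ <-]; exists (f + g) => //; rewrite rmorphD.
    - move=> k; exists (s ^+ k *: 'X^k) => //.
      by rewrite linearZ /= rmorphXn /= horner_algX mul1r exprZn mulr_algl.
  rewrite -scaleN1r addrC scalerA; apply: (closure_of_lin (S := range (horner_alg e)) _ _ hr1).
    by move=> _ _ [f _ <-] [g _ <-]; exists ((-1 * t) *: f + g) => //; rewrite linearP /= mulr_algl.
  apply: closure_of_sub; exists 1 => //; exact: rmorph1.
have [phiX phiY phiXY] := bifree_geometric p q
  (fun i => resolvent_poly _ _ _ _ (xb i) (xR i)) u0
  (fun i => resolvent_poly _ _ _ _ (yb i) (yQ i)) v0 bM bN hM hN.
have pu i : p%:A + u i = R i by rewrite addrC subrK.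
have qv i : q%:A + v i = Q i by rewrite addrC subrK.
have uv i : phi (u i * v i) = kappa i.
  move: (u i) (v i) (u0 i) (v0 i) (pu i) (qv i) => ui vi ui0 vi0 Ri Qi.
  suff e : phi (R i * Q i) = p * q + phi (ui * vi) by rewrite /kappa e addrC addKr.
  rewrite -Ri -Qi !(mulrDl, mulrDr) !(mulr_algl, mulr_algr).
  by rewrite ![in LHS](linearD, linearZ) /= phi1 ui0 vi0; ring.
move: phiX phiY phiXY; rewrite !pu !qv !uv => phiX phiY phiXY.
split.
- by rewrite LE linearZ /= phiX mulKf.
- by rewrite KE linearZ /= phiY mulKf.
have HE i : phi (R i * Q i) = p * q + kappa i by rewrite addrC subrK.
rewrite LE KE -scalerAl -scalerAr [phi (_ *: _)]linearZ [phi (_ *: _)]linearZ /=.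
have -> : z * w * p * q - kappa false * kappa true =
  z * w * p * q * (1 - (z * p)^-1 * (w * q)^-1 * (kappa false * kappa true)).
  by field; rewrite z0 w0 p0 q0.
rewrite !HE -[RHS]mulrA -phiXY; field.
by rewrite z0 w0 p0 q0.
Qed.

End BifreeResolvents.

(** * The moment series and their inverses *)

Section Series.
Variables (C : numClosedFieldType) (A : vonNeumannAlgebra C).
Hypothesis C_pow2 : pow2_small C.

(** The value is 0 where [1 - z a] has no inverse; the estimates below stay where [z a] has bound
    [2^-1]. *)
Definition resolvent (a : A) (z : C) : A := xget 0 [set r | is_inv (1 - z *: a) r].

Lemma resolventP (a : A) z : opbound (z *: a) 2^-1 ->
  is_inv (1 - z *: a) (resolvent a z) /\ opbound (resolvent a z) 2.
Proof.
move=> h; have [r hr rb] := neumann_inv C_pow2 h.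
have hR : is_inv (1 - z *: a) (resolvent a z) by apply: (xgetPex 0); exists r.
by split=> //; rewrite (is_inv_uniq hR hr).
Qed.

Lemma resolvent_eq (a r : A) z : is_inv (1 - z *: a) r -> resolvent a z = r.
Proof.
move=> hr; apply: (is_inv_uniq _ hr).
by rewrite /resolvent; case: xgetP => [y -> //|/(_ r)].
Qed.

Lemma resolvent_sub1 (a : A) z : opbound (z *: a) 2^-1 ->
  resolvent a z - 1 = z *: (a * resolvent a z) /\
  resolvent a z - 1 = z *: (resolvent a z * a).
Proof.
move=> /resolventP [/is_invP [h1 h2] _].
by rewrite scalerAl h2 scalerAr h1.
Qed.

Lemma resolvent0 (a : A) : resolvent a 0 = 1.
Proof. by apply: resolvent_eq; rewrite scale0r subr0; split; rewrite mulr1. Qed.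

Lemma resolvent_identity (a : A) z z' :
  opbound (z *: a) 2^-1 -> opbound (z' *: a) 2^-1 ->
  resolvent a z - resolvent a z' = (z - z') *: (resolvent a z * a * resolvent a z').
Proof.
move=> /resolventP [[_ h] _] /resolventP [[h' _] _].
have -> : resolvent a z - resolvent a z' =
    resolvent a z * ((1 - z' *: a) - (1 - z *: a)) * resolvent a z'.
  by rewrite mulrBr mulrBl h mul1r -mulrA h' mulr1.
rewrite opprB [1 - _ + _]addrC addrA subrK -scalerBl.
by rewrite -scalerAr -scalerAl.
Qed.

Lemma opbound_near (a : A) (e : C) : 0 < e ->
  exists2 d, 0 < d & forall z, `|z| <= d -> opbound (z *: a) e.
Proof.
move=> e0; have [k [k0 hk]] := opbound_ex a.
have k1 : 0 < k + 1 by rewrite ltr_wpDl.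
exists (e / (k + 1)); first exact: divr_gt0.
move=> z hz; apply: opbound_le (opboundZ z (conj k0 hk)) _.
apply: (@le_trans _ _ (e / (k + 1) * (k + 1))); last by rewrite divfK ?gt_eqF.
by apply: ler_pM => //; rewrite lerDl ler01.
Qed.

Variable phi : {scalar A}.
Hypothesis phi_state : is_state phi.

Lemma PsiE (a : A) z : opbound (z *: a) 2^-1 ->
  Psi phi a z = phi (resolvent a z) - 1.
Proof.
move=> h; have [hR _] := resolventP h.
have := @neumann_series _ _ C_pow2 _ phi_state _ _ 1 1 h hR; rewrite mul1r mulr1 => hc.
apply/cvg_lim; first exact: norm_hausdorff.
have : (\sum_(0 <= n < N) phi (1 * (z *: a) ^+ n * 1) - 1) @[N --> \oo] -->
    phi (resolvent a z) - 1 by apply: cvgB => //; exact: cvg_cst.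
apply: cvg_trans; apply: near_eq_cvg; near=> N.
(* The Neumann sum starts at [n = 0] and [Psi] at [n = 1]; the extra term is [phi 1 = 1], and it can
   be split off once [N] is positive. *)
rewrite (@big_ltn _ _ _ 0%N N) /=; last by near: N; exists 1%N.
rewrite expr0 !mulr1 (state1 phi_state) addrC addKr.
apply: eq_bigr => n _; rewrite mul1r mulr1 exprZn linearZ /=; exact: mulrC.
Unshelve. all: by end_near. Qed.

Lemma HseriesE (a b : A) z w : opbound (z *: a) 2^-1 -> opbound (w *: b) 2^-1 ->
  Hseries phi a b z w = phi (resolvent a z * resolvent b w).
Proof.
move=> ha hb; have [hR _] := resolventP ha; have [hQ _] := resolventP hb.
have inner m : limn (fun N => \sum_(0 <= n < N) phi (a ^+ m * b ^+ n) * z ^+ m * w ^+ n) =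
    phi (1 * (z *: a) ^+ m * resolvent b w).
  have := @neumann_series _ _ C_pow2 _ phi_state _ _ ((z *: a) ^+ m) 1 hb hQ.
  rewrite mulr1 mul1r => hc; apply/cvg_lim; first exact: norm_hausdorff.
  apply: cvg_trans hc; apply: near_eq_cvg; near=> N.
  apply: eq_bigr => n _; rewrite mulr1 !exprZn -scalerAl -scalerAr !linearZ /=.
  by rewrite mulrA mulrC mulrA.
apply/cvg_lim; first exact: norm_hausdorff.
have := @neumann_series _ _ C_pow2 _ phi_state _ _ 1 (resolvent b w) ha hR.
rewrite mul1r; apply: cvg_trans; apply: near_eq_cvg; near=> M.
by apply: eq_bigr => m _; rewrite inner.
Unshelve. all: by end_near. Qed.

End Series.

Section InverseFunction.
Variables (C : numClosedFieldType) (A : vonNeumannAlgebra C).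
Hypothesis C_pow2 : pow2_small C.
Variable phi : {scalar A}.
Hypothesis phi_state : is_state phi.

(** The order of [C] is partial, but positive elements are real and hence comparable. *)
Lemma exists_pos_lower (d1 d2 : C) : 0 < d1 -> 0 < d2 ->
  exists2 d, 0 < d & d <= d1 /\ d <= d2.
Proof.
move=> h1 h2; case: (real_leP (gtr0_real h1) (gtr0_real h2)) => h.
  by exists d1.
by exists d2 => //; split=> //; exact: ltW.
Qed.

Lemma near0_normP (V : normedModType C) (P : V -> Prop) :
  (\forall z \near (0 : V), P z) <-> exists2 d, 0 < d & forall z, `|z| < d -> P z.
Proof.
split=> [/nbhs_normP[d /= d0 h]|[d d0 h]].
  by exists d => // z hz; apply: h; rewrite /ball_ /= sub0r normrN.
by apply/nbhs_normP; exists d => // z; rewrite /ball_ /= sub0r normrN; exact: h.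
Qed.

Lemma cvg0P (g : C -> C) : g z @[z --> (0 : C)] --> (0 : C) <->
  forall e, 0 < e -> exists2 d, 0 < d & forall z, `|z| < d -> `|g z| < e.
Proof.
split=> [|h].
  move=> /(@cvgrPdist_lt C C C (nbhs (0 : C))) h e e0.
  have : \forall z \near (0 : C), `|0 - g z| < e := h e e0.
  move=> /near0_normP [d d0 hd]; exists d => // z /hd.
  by rewrite sub0r normrN.
apply/(@cvgrPdist_lt C C C (nbhs (0 : C)) _ g 0) => e e0.
have [d d0 hd] := h e e0.
suff : \forall z \near (0 : C), `|0 - g z| < e by [].
apply/near0_normP; exists d => // z /hd.
by rewrite sub0r normrN.
Qed.

Lemma resolvent_sub1_bound (a : A) z e : opbound (z *: a) e -> e <= 2^-1 ->
  opbound (resolvent a z - 1) (e * 2).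
Proof.
move=> he e2; have h := opbound_le he e2.
rewrite (resolvent_sub1 C_pow2 h).1 scalerAl; apply: opboundM => //.
by have [] := resolventP C_pow2 h.
Qed.

Lemma resolvent_product_near (a x b : A) (e : C) : 0 < e ->
  exists2 d, 0 < d & forall z w, `|z| <= d -> `|w| <= d ->
    [/\ opbound (z *: a) 2^-1, opbound (w *: b) 2^-1 &
      `|phi (resolvent a z * x * resolvent b w) - phi x| <= e].
Proof.
move=> e0; have [k [k0 hk]] := opbound_ex x.
(* With [z a] and [w b] bounded by [t] and both resolvents by 2, the error is at most
   [4 t k + 2 t k]; the added 1 covers [k = 0]. *)
have k6 : 0 < 6 * (k + 1) by rewrite mulr_gt0 ?ltr0n // ltr_wpDl.
have h2 : (0 : C) < 2^-1 by rewrite invr_gt0 ltr0n.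
have [t t0 [t2 te]] := exists_pos_lower h2 (divr_gt0 e0 k6).
have [d1 d10 h1] := opbound_near a t0; have [d2 d20 h2'] := opbound_near b t0.
have [d d0 [dd1 dd2]] := exists_pos_lower d10 d20.
exists d => // z w hz hw.
have {h1}hz := h1 z (le_trans hz dd1); have {h2'}hw := h2' w (le_trans hw dd2).
have hz2 := opbound_le hz t2; have hw2 := opbound_le hw t2.
split=> //; rewrite -linearB.
have -> : resolvent a z * x * resolvent b w - x =
    (resolvent a z - 1) * (x * resolvent b w) + x * (resolvent b w - 1).
  by rewrite mulrBl mul1r mulrA mulrBr mulr1 addrA subrK.
have [_ bw] := resolventP C_pow2 hw2.
have := opboundD
  (opboundM (resolvent_sub1_bound hz t2) (opboundM (conj k0 hk) bw))
  (opboundM (conj k0 hk) (resolvent_sub1_bound hw t2)).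
move=> /(state_opbound phi_state) /le_trans; apply.
have -> : t * 2 * (k * 2) + k * (t * 2) = t * (6 * k) by ring.
apply: (@le_trans _ _ (e / (6 * (k + 1)) * (6 * (k + 1)))).
  by apply: ler_pM; rewrite ?mulr_ge0 ?(ltW t0) // ler_wpM2l // lerDl ler01.
by rewrite divfK // gt_eqF.
Qed.

(** By the resolvent identity the difference quotient of [Psi] is [phi (R a R')], which is close to
    [phi a] near the origin. This strict differentiability drives the inversion. *)
Lemma Psi_lipschitz (a : A) : phi a != 0 ->
  exists2 d, 0 < d & forall z z', `|z| <= d -> `|z'| <= d ->
    opbound (z *: a) 2^-1 /\
    `|Psi phi a z - Psi phi a z' - phi a * (z - z')| <= `|phi a| / 2 * `|z - z'|.
Proof.
move=> c0; have e0 : 0 < `|phi a| / 2 by rewrite divr_gt0 ?normr_gt0 // ltr0n.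
have [d d0 hd] := resolvent_product_near a a a e0.
exists d => // z z' hz hz'; have [bz bz' h] := hd _ _ hz hz'; split=> //.
rewrite !PsiE // opprB addrA subrK -linearB resolvent_identity // linearZ /=.
by rewrite [phi a * _]mulrC -mulrBr normrM mulrC ler_wpM2r.
Qed.

Lemma Psi0 (a : A) : Psi phi a 0 = 0.
Proof.
rewrite PsiE // ?resolvent0 ?(state1 phi_state) ?subrr // scale0r.
by apply: opbound_le (opbound0 A) _; rewrite invr_ge0 ler0n.
Qed.

Hypothesis C_complete : @geometric_complete C C.

(** For a target [s], the simplified Newton map [z - (f z - s) / c] is a contraction of ratio
    [2^-1]. It sends 0 to [s / c], whence the radius [2 |s| / |c|]. *)
Lemma Psi_comp_inverse (a : A) : phi a != 0 ->
  exists g, is_comp_inverse (Psi phi a) g.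
Proof.
move=> c0; have [d d0 hd] := Psi_lipschitz c0.
set c := phi a in c0 hd; set f := Psi phi a.
have c_gt0 : 0 < `|c| by rewrite normr_gt0.
have h0 : `|0 : C| <= d by rewrite normr0 ltW.
have f0 : f 0 = 0 := Psi0 a.
have hsol s : `|s| <= `|c| * d / 2 ->
    exists2 z, `|z| <= 2 * `|s| / `|c| & f z = s.
  move=> hs; have rd : 2 * `|s| / `|c| <= d.
    rewrite ler_pdivrMr // mulrC -ler_pdivlMr ?ltr0n //.
    by rewrite [d * _]mulrC.
  have T0 : `|0 - (f 0 - s) / c| <= 2 * `|s| / `|c| * 2^-1.
    rewrite f0 !sub0r mulNr opprK normrM normfV.
    by rewrite mulrAC [2 * _]mulrC mulfK ?pnatr_eq0.
  have [|z hz hfz] := @contraction_fixpoint _ C_pow2 _ C_complete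
    (fun z : C => z - (f z - s) / c) (2 * `|s| / `|c|) T0.
    move=> x y hx hy.
    have [_ h] := hd _ _ (le_trans hx rd) (le_trans hy rd).
    have -> : x - (f x - s) / c - (y - (f y - s) / c) =
        - (f x - f y - c * (x - y)) / c by field.
    rewrite normrM normrN normfV ler_pdivrMr //.
    by apply: le_trans h _; rewrite -mulrA mulrC.
  exists z => //; apply/eqP; rewrite -subr_eq0.
  move/eqP: hfz; rewrite -subr_eq0 addrAC subrr add0r oppr_eq0 mulf_eq0 invr_eq0.
  by rewrite (negbTE c0) orbF.
pose g s := xget 0 [set z | `|z| <= 2 * `|s| / `|c| /\ f z = s].
have gP s : `|s| <= `|c| * d / 2 -> `|g s| <= 2 * `|s| / `|c| /\ f (g s) = s.
  move=> /hsol [z hz fz].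
  by have := xgetPex 0 (ex_intro (fun z => `|z| <= 2 * `|s| / `|c| /\ f z = s)
    z (conj hz fz)).
have e0 : 0 < `|c| * d / 2 by rewrite divr_gt0 ?mulr_gt0 // ltr0n.
have f_inj z z' : `|z| <= d -> `|z'| <= d -> f z = f z' -> z = z'.
  move=> hz hz' fz; have [_] := hd _ _ hz hz'; rewrite -/f fz subrr sub0r normrN normrM.
  rewrite -mulrA ler_pM2l // mulrC; set t := `|z - z'| => ht.
  apply/eqP; rewrite -subr_eq0 -normr_le0 -/t.
  move: ht; rewrite {1}(splitr t) gerDl pmulr_lle0 // invr_gt0 ltr0n //.
exists g; split.
- apply/near0_normP; exists (`|c| * d / 2) => // s /ltW hs; exact: (gP s hs).2.
(* Since [|f z| <= 2 |c| |z|], the radius [d / 4] puts [f z] within [|c| d / 2], where [g] is known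
   to solve the equation. *)
- apply/near0_normP; exists (d / 4); first by rewrite divr_gt0 // ltr0n.
  move=> z hz; have zd : `|z| <= d.
    by apply: le_trans (ltW hz) _; rewrite ler_pdivrMr ?ltr0n // ler_peMr ?ler1n // ltW.
  have fz : `|f z| <= 2 * `|c| * `|z|.
    have [_] := hd _ _ zd h0; rewrite -/f f0 !subr0 => h.
    rewrite -(subrK (c * z) (f z)); apply: le_trans (ler_normD _ _) _.
    rewrite normrM -mulrA [2 * _]mulrDl !mul1r lerD //.
    apply: le_trans h _; rewrite -mulrA ler_wpM2l //.
    by rewrite ler_piMl // invf_le1 ?ltr0n // ler1n.
  have fzd : `|f z| <= `|c| * d / 2.
    apply: le_trans fz _; rewrite [2 * _]mulrC -!mulrA ler_wpM2l //.
    rewrite mulrC; apply: le_trans (ler_wpM2r _ (ltW hz)) _; first by rewrite ler0n.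
    by rewrite le_eqVlt; apply/orP; left; apply/eqP; field.
  have [h1 h2] := gP _ fzd; apply: f_inj => //.
  apply: le_trans h1 _; rewrite ler_pdivrMr //.
  apply: le_trans (ler_wpM2l _ fzd) _; first by rewrite ler0n.
  by rewrite le_eqVlt; apply/orP; left; apply/eqP; field.
- apply/cvg0P => e ep.
  have e1 : 0 < e * `|c| / 2 by rewrite divr_gt0 ?mulr_gt0 // ltr0n.
  have [t t0 [t1 t2]] := exists_pos_lower e0 e1.
  exists t => // s hs.
  have [h1 _] := gP s (le_trans (ltW hs) t1).
  apply: le_lt_trans h1 _; rewrite ltr_pdivrMr // mulrC -ltr_pdivlMr ?ltr0n //.
  exact: lt_le_trans t2.
Qed.

Lemma Psi_inv_is_comp_inverse (a : A) : phi a != 0 ->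
  is_comp_inverse (Psi phi a) (Psi_inv phi a).
Proof. by move=> /Psi_comp_inverse [g hg]; apply: getPex; exists g. Qed.

(** Mere continuity at 0 would not suffice: the linear bound on the inverse is what later makes
    [x_1 x_2 / z] small. *)
Lemma Psi_inv_near (a : A) : phi a != 0 ->
  exists2 K, 0 < K & exists2 d, 0 < d & forall s, `|s| < d ->
    let x := Psi_inv phi a s in
    [/\ opbound (x *: a) 2^-1, phi (resolvent a x) = 1 + s & `|x| <= K * `|s|].
Proof.
move=> c0; have [d d0 hd] := Psi_lipschitz c0.
have [/near0_normP [d1 d10 h1] _ /cvg0P/(_ _ d0) [d2 d20 h2]] :=
  Psi_inv_is_comp_inverse c0.
have [t t0 [t1 t2]] := exists_pos_lower d10 d20.
have c_gt0 : 0 < `|phi a| by rewrite normr_gt0.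
exists (2 / `|phi a|); first by rewrite divr_gt0 // ltr0n.
exists t => // s hs x.
have hx : `|x| <= d.
  exact: ltW (h2 s (lt_le_trans hs t2)).
have fx : Psi phi a x = s := h1 s (lt_le_trans hs t1).
have [bx h] : opbound (x *: a) 2^-1 /\ `|s - phi a * x| <= `|phi a| / 2 * `|x|.
  have [] := hd x 0 hx; first by rewrite normr0 ltW.
  by rewrite Psi0 !subr0 fx.
split=> //; first by rewrite addrC -fx PsiE // subrK.
rewrite mulrAC ler_pdivlMr // mulrC -normrM.
have : `|phi a * x| <= `|s| + `|phi a| / 2 * `|x|.
  rewrite -(subrK s (phi a * x)) addrC; apply: le_trans (ler_normD _ _) _.
  by rewrite lerD2l distrC.
rewrite mulrAC -normrM {1}(splitr `|phi a * x|) lerD2r ler_pdivrMr ?ltr0n //.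
by rewrite [2 * _]mulrC.
Qed.

End InverseFunction.

(** * Matrix-valued transforms *)

Section UpperTriangular.
Variable C : numClosedFieldType.

Lemma mulmx2E (S : pzRingType) (M N : 'M[S]_2) i j :
  (M *m N) i j = M i 0 * N 0 j + M i 1 * N 1 j.
Proof.
rewrite mxE !big_ord_recl big_ord0 addr0.
by rewrite (_ : lift ord0 ord0 = 1) //; apply: val_inj.
Qed.

Lemma matrix2P (S : Type) (M N : 'M[S]_2) :
  M 0 0 = N 0 0 -> M 0 1 = N 0 1 -> M 1 0 = N 1 0 -> M 1 1 = N 1 1 -> M = N.
Proof.
have ord2 (i : 'I_2) : i = 0 \/ i = 1.
  by case: i => [[|[|//]] h]; [left|right]; apply: val_inj.
move=> h00 h01 h10 h11; apply/matrixP => i j.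
by case: (ord2 i) => ->; case: (ord2 j) => ->.
Qed.

Lemma upper2E z zeta w : [/\ @upper2 C z zeta w 0 0 = z, @upper2 C z zeta w 0 1 = zeta,
  @upper2 C z zeta w 1 0 = 0 & @upper2 C z zeta w 1 1 = w].
Proof. by rewrite !mxE. Qed.

Lemma upper2_eta (G : 'M[C]_2) : is_upper2 G -> G = upper2 (G 0 0) (G 0 1) (G 1 1).
Proof. by move=> h; apply: matrix2P; rewrite !mxE. Qed.

Lemma is_upper2_upper2 z zeta w : is_upper2 (@upper2 C z zeta w).
Proof. by rewrite /is_upper2 !mxE. Qed.

Lemma upper2_mul a b c a' b' c' :
  @upper2 C a b c *m upper2 a' b' c' = upper2 (a * a') (a * b' + b * c') (c * c').
Proof. by apply: matrix2P; rewrite mulmx2E !mxE /= ?(mulr0, mul0r, addr0, add0r). Qed.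

Lemma upper2_add1 a b c : 1%:M + @upper2 C a b c = upper2 (1 + a) b (1 + c).
Proof. by apply: matrix2P; rewrite !mxE /= ?(mulr0n, mulr1n, add0r, addr0). Qed.

Lemma upper2_1 : @upper2 C 1 0 1 = 1%:M.
Proof. by apply: matrix2P; rewrite !mxE. Qed.

Lemma upper2_inv a b c : a != 0 -> c != 0 ->
  @upper2 C a b c \in unitmx /\
  invmx (@upper2 C a b c) = upper2 a^-1 (- (b / (a * c))) c^-1.
Proof.
move=> a0 c0; set N := upper2 a^-1 _ _.
have h : upper2 a b c *m N = 1%:M.
  rewrite upper2_mul -upper2_1 !mulfV //; congr (upper2 _ _ _).
  by field; rewrite a0 c0.
have [u _] := mulmx1_unit h; split=> //.
by rewrite -[LHS]mulmx1 -h mulmxA mulVmx // mul1mx.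
Qed.

Lemma upper2_unit a b c : @upper2 C a b c \in unitmx -> a != 0 /\ c != 0.
Proof.
move=> u; have h := mulmxV u; have h' := mulVmx u.
have e0 : invmx (upper2 a b c) 0 0 * a = 1.
  have /matrixP/(_ 0 0) := h'.
  by rewrite mulmx2E !mxE /= mulr0 addr0.
have e1 : c * invmx (upper2 a b c) 1 1 = 1.
  have /matrixP/(_ 1 1) := h.
  by rewrite mulmx2E !mxE /= mul0r add0r.
split; apply/eqP => z0.
  by move/eqP: e0; rewrite z0 mulr0 eq_sym oner_eq0.
by move/eqP: e1; rewrite z0 mul0r eq_sym oner_eq0.
Qed.

Lemma near2P (P : C -> C -> Prop) :
  (\forall z \near (0 : C) & w \near (0 : C), P z w) <->
  exists2 d, 0 < d & forall z w, `|z| < d -> `|w| < d -> P z w.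
Proof.
split=> [[[U V] /= [hU hV] h]|[d d0 h]].
  have /near0_normP [d1 d10 h1] : \forall z \near (0 : C), U z by [].
  have /near0_normP [d2 d20 h2] : \forall z \near (0 : C), V z by [].
  have [d d0 [dd1 dd2]] := exists_pos_lower d10 d20.
  exists d => // z w hz hw; apply: (h (z, w)); split=> /=.
    by apply: h1; exact: lt_le_trans dd1.
  by apply: h2; exact: lt_le_trans dd2.
have hd : \forall z \near (0 : C), `|z| < d by apply/near0_normP; exists d.
exists ([set z | `|z| < d], [set z | `|z| < d]) => //=.
by move=> [z w] /= [hz hw]; exact: h.
Qed.

Lemma near_diag0P (P : 'M[C]_2 -> Prop) : near_diag0 P <->
  exists2 d, 0 < d & forall z zeta w, `|z| < d -> `|w| < d -> P (upper2 z zeta w).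
Proof.
rewrite /near_diag0; split=> [/near2P|] [d d0 h].
  by exists d => // z zeta w hz hw; exact: h.
by apply/near2P; exists d => // z w hz hw zeta; exact: h.
Qed.

End UpperTriangular.

Section MatrixTransform.
Variables (C : numClosedFieldType) (A : vonNeumannAlgebra C).
Hypothesis C_pow2 : pow2_small C.
Variable phi : {scalar A}.
Hypothesis phi_state : is_state phi.

Lemma ring_inv_eq (M Y : 'M[A]_2) : M *m Y = 1%:M -> Y *m M = 1%:M -> ring_inv M = Y.
Proof.
move=> h1 h2; have [h3 h4] : [set Z | M *m Z = 1%:M /\ Z *m M = 1%:M] (ring_inv M).
  by apply: (xgetPex 0); exists Y.
by rewrite -[LHS]mulmx1 -h1 mulmxA h4 mul1mx.
Qed.

Lemma diag2_mul (a b a' b' : A) : diag2 a b *m diag2 a' b' = diag2 (a * a') (b * b').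
Proof. by apply: matrix2P; rewrite mulmx2E !mxE /= ?(mulr0, mul0r, addr0, add0r). Qed.

(** The coefficient of [zeta] in the off-diagonal entry of [E((1 - Gamma X)^-1)]; its value at the
    origin is [phi b]. *)
Definition off_diag (a b : A) (z w : C) : C := phi (resolvent a z * b * resolvent b w).

Lemma PsiME (a b : A) z zeta w : opbound (z *: a) 2^-1 -> opbound (w *: b) 2^-1 ->
  PsiM phi (diag2 a b) (upper2 z zeta w) =
  upper2 (phi (resolvent a z) - 1) (zeta * off_diag a b z w) (phi (resolvent b w) - 1).
Proof.
move=> ha hb; have [[r1 r2] _] := resolventP C_pow2 ha.
have [[q1 q2] _] := resolventP C_pow2 hb.
rewrite /PsiM /E2 /off_diag; set R := resolvent a z in r1 r2 *; set Q := resolvent b w in q1 q2 *.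
pose Y : 'M[A]_2 := \matrix_(i, j)
  if i == j then (if i == 0 then R else Q)
  else if i == 0 then zeta *: (R * b * Q) else 0.
have -> : ring_inv (1%:M - scal2 A (upper2 z zeta w) *m diag2 a b) = Y.
  have SD : scal2 A (upper2 z zeta w) *m diag2 a b = \matrix_(i, j)
      if i == j then (if i == 0 then z *: a else w *: b)
      else if i == 0 then zeta *: b else 0.
    by apply: matrix2P; rewrite mulmx2E !mxE /= ?(mulr0, mul0r, addr0, add0r, mulr_algl, scale0r).
  have ME i j : (1%:M - scal2 A (upper2 z zeta w) *m diag2 a b) i j =
    (i == j)%:R - if i == j then (if i == 0 then z *: a else w *: b)
      else if i == 0 then zeta *: b else 0.
    by rewrite SD !mxE.
  apply: ring_inv_eq; apply: matrix2P;
    rewrite mulmx2E !ME !mxE /= ?(subr0, sub0r, mulr0, mul0r, addr0, add0r) //.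
  - by rewrite -scalerAr !mulrA r1 mul1r mulNr -scalerAl subrr.
  - by rewrite mulrN -!scalerAr -scalerAl -[R * b * Q * _]mulrA q2 mulr1 addNr.
apply: matrix2P; rewrite !mxE /= ?(mulr0n, mulr1n, subr0) //.
- by rewrite linearZ.
- by rewrite linear0.
Qed.

Lemma off_diag_neq0 (a b : A) : phi b != 0 ->
  exists2 d, 0 < d & forall z w, `|z| <= d -> `|w| <= d ->
    [/\ opbound (z *: a) 2^-1, opbound (w *: b) 2^-1 & off_diag a b z w != 0].
Proof.
move=> b0; have e0 : 0 < `|phi b| / 2 by rewrite divr_gt0 ?normr_gt0 // ltr0n.
have [d d0 hd] := resolvent_product_near C_pow2 phi_state a b b e0.
exists d => // z w hz hw; have [ha hb h] := hd z w hz hw; split=> //.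
apply/eqP => h0; move: h; rewrite -/(off_diag a b z w) h0 sub0r normrN.
by rewrite {1}(splitr `|phi b|) gerDl => /(lt_le_trans e0); rewrite ltxx.
Qed.

Hypothesis C_complete : @geometric_complete C C.

Lemma Psi_inv_pair (a b : A) : phi a != 0 -> phi b != 0 ->
  exists2 K, 0 < K & exists2 d, 0 < d & forall z w, `|z| < d -> `|w| < d ->
    let x := Psi_inv phi a z in let y := Psi_inv phi b w in
    [/\ opbound (x *: a) 2^-1 /\ opbound (y *: b) 2^-1,
        phi (resolvent a x) = 1 + z /\ phi (resolvent b y) = 1 + w,
        `|x| <= K * `|z| /\ `|y| <= K * `|w| & off_diag a b x y != 0].
Proof.
move=> a0 b0.
have [Ka Ka0 [da da0 ha]] := Psi_inv_near C_pow2 phi_state C_complete a0.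
have [Kb Kb0 [db db0 hb]] := Psi_inv_near C_pow2 phi_state C_complete b0.
have [t t0 ht] := off_diag_neq0 a b0.
have K0 : 0 < Ka + Kb by rewrite addr_gt0.
have [d1 d10 [d1a d1b]] := exists_pos_lower da0 db0.
have [d d_gt0 [dd1 ddt]] := exists_pos_lower d10 (divr_gt0 t0 K0).
exists (Ka + Kb) => //; exists d => // z w hz hw x y.
have [ax fx xK] := ha z (lt_le_trans hz (le_trans dd1 d1a)).
have [b_y fy yK] := hb w (lt_le_trans hw (le_trans dd1 d1b)).
have xK' : `|x| <= (Ka + Kb) * `|z|.
  by apply: le_trans xK _; rewrite ler_wpM2r // lerDl ltW.
have yK' : `|y| <= (Ka + Kb) * `|w|.
  by apply: le_trans yK _; rewrite ler_wpM2r // lerDr ltW.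
have xt : `|x| <= t.
  apply: le_trans xK' _; rewrite mulrC -ler_pdivlMr //.
  exact: le_trans (ltW hz) ddt.
have yt : `|y| <= t.
  apply: le_trans yK' _; rewrite mulrC -ler_pdivlMr //.
  exact: le_trans (ltW hw) ddt.
by split=> //; have [] := ht x y xt yt.
Qed.

(** [PsiM] applies the scalar series to the diagonal and multiplies [zeta] by [off_diag], so it is
    inverted entry by entry. It is linear in [zeta], and only the diagonal has to be small. *)
Definition PsiM_inv_upper (a b : A) (G : 'M[C]_2) : 'M[C]_2 :=
  let x := Psi_inv phi a (G 0 0) in let y := Psi_inv phi b (G 1 1) in
  upper2 x (G 0 1 / off_diag a b x y) y.

Lemma PsiM_inv_upper_comp (a b : A) : phi a != 0 -> phi b != 0 ->
  is_comp_inverseM (PsiM phi (diag2 a b)) (PsiM_inv_upper a b).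
Proof.
move=> a0 b0.
have [K K0 [d d0 hd]] := Psi_inv_pair a0 b0.
have [t t0 ht] := off_diag_neq0 a b0.
split.
- apply/near_diag0P; exists 1 => // z zeta w _ _; exact: is_upper2_upper2.
- apply/near_diag0P; exists d => // z zeta w hz hw.
  have [[hxa hyb] [fx fy] _ k0] := hd z w hz hw.
  rewrite /PsiM_inv_upper; have [-> -> _ ->] := upper2E z zeta w.
  by rewrite PsiME // fx fy divfK // ![1 + _ - 1]addrAC subrr !add0r.
- have [_ /near0_normP [da da0 ha] _] := Psi_inv_is_comp_inverse C_pow2 phi_state C_complete a0.
  have [_ /near0_normP [db db0 hb] _] := Psi_inv_is_comp_inverse C_pow2 phi_state C_complete b0.
  have [d1 d10 [d1a d1b]] := exists_pos_lower da0 db0.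
  have [e e0 [ed1 et]] := exists_pos_lower d10 t0.
  apply/near_diag0P; exists e => // z zeta w hz hw.
  have [az bw k0] := ht z w (le_trans (ltW hz) et) (le_trans (ltW hw) et).
  rewrite PsiME // /PsiM_inv_upper.
  have [-> -> _ ->] := upper2E (phi (resolvent a z) - 1) (zeta * off_diag a b z w)
    (phi (resolvent b w) - 1).
  rewrite -!PsiE // ha ?hb ?mulfK //.
    exact: lt_le_trans hw (le_trans ed1 d1b).
  exact: lt_le_trans hz (le_trans ed1 d1a).
- move=> e e0; have [t' t'0 [t1 t2]] := exists_pos_lower d0 (divr_gt0 e0 K0).
  apply/near_diag0P; exists t' => // z zeta w hz hw.
  have [_ _ [xK yK] _] := hd z w (lt_le_trans hz t1) (lt_le_trans hw t1).
  rewrite /PsiM_inv_upper; have [-> -> _ ->] := upper2E z zeta w; rewrite !mxE /=.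
  split; [apply: le_lt_trans xK _|apply: le_lt_trans yK _]; rewrite mulrC -ltr_pdivlMr //.
    exact: lt_le_trans t2.
  exact: lt_le_trans t2.
Qed.

(** Uniqueness of the germ: with [f], [g], [h] the transform, the explicit inverse and the chosen
    one, [h G = h (f (g G)) = g G], because [g G] has small diagonal. *)
Lemma PsiM_invE (a b : A) : phi a != 0 -> phi b != 0 ->
  near_diag0 (fun G => PsiM_inv phi (diag2 a b) G = PsiM_inv_upper a b G).
Proof.
move=> a0 b0; have hu := PsiM_inv_upper_comp a0 b0.
have : is_comp_inverseM (PsiM phi (diag2 a b)) (PsiM_inv phi (diag2 a b)).
  by apply: getPex; exists (PsiM_inv_upper a b).
move=> [_ _ /near_diag0P [d d0 hd] _].
case: hu => _ /near_diag0P [d1 d10 h1] _ /(_ _ d0) /near_diag0P [d2 d20 h2].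
have [e e0 [ed1 ed2]] := exists_pos_lower d10 d20.
apply/near_diag0P; exists e => // z zeta w hz hw.
have [s1 s2] := h2 z zeta w (lt_le_trans hz ed2) (lt_le_trans hw ed2).
have := h1 z zeta w (lt_le_trans hz ed1) (lt_le_trans hw ed1).
set G := PsiM_inv_upper a b _ in s1 s2 *; move=> {1}<-.
have GE : G = upper2 (G 0 0) (G 0 1) (G 1 1) by apply: upper2_eta; exact: is_upper2_upper2.
by rewrite GE hd.
Qed.

Lemma SM_E (a b : A) : phi a != 0 -> phi b != 0 ->
  exists2 d, 0 < d & forall z zeta w, `|z| < d -> `|w| < d -> z != 0 -> w != 0 ->
    let x := Psi_inv phi a z in let y := Psi_inv phi b w in
    SM phi (diag2 a b) (upper2 z zeta w) =
    upper2 ((1 + z) / z * x)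
      (zeta * ((1 + z) / (z * off_diag a b x y) - y / (z * w)))
      ((1 + w) / w * y).
Proof.
move=> a0 b0; have [d1 d10 h1] := (near_diag0P _).1 (PsiM_invE a0 b0).
have [K K0 [d2 d20 h2]] := Psi_inv_pair a0 b0.
have [d d0 [dd1 dd2]] := exists_pos_lower d10 d20.
exists d => // z zeta w hz hw z0 w0 x y.
have [_ _ _ k0] := h2 z w (lt_le_trans hz dd2) (lt_le_trans hw dd2).
rewrite /SM (h1 z zeta w (lt_le_trans hz dd1) (lt_le_trans hw dd1)).
rewrite (upper2_inv zeta z0 w0).2 upper2_add1 /PsiM_inv_upper.
have [-> -> _ ->] := upper2E z zeta w; rewrite -/x -/y -/(off_diag a b x y) in k0 *.
rewrite !upper2_mul; congr (upper2 _ _ _); by field; rewrite ?z0 ?w0 ?k0.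
Qed.

(** Since [y b Q = Q - 1], the matrix entry is expressed by the two-variable moment; this links the
    matrix transforms to [S_{a,b}]. *)
Lemma off_diagE (a b : A) x y : opbound (y *: b) 2^-1 ->
  y * off_diag a b x y = phi (resolvent a x * resolvent b y) - phi (resolvent a x).
Proof.
move=> hb; rewrite -linearB -{2}[resolvent a x]mulr1 -mulrBr (resolvent_sub1 C_pow2 hb).1.
by rewrite -scalerAr linearZ /= mulrA.
Qed.

End MatrixTransform.

(** * The S-transform identity *)

Section ScalarIdentity.
Variable C : fieldType.

(** Here [k1], [k2], [k12] are values of [off_diag], and the [k_j] of the overview are [kappa1],
    [kappa2]. The equation compares the off-diagonal entries divided by [zeta]. After clearing
    denominators, the difference of its sides is [- w p kappa1 kappa2 D] with [D] nonzero. *)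
Lemma off_diag_identity (z w p q y1 y2 k1 k2 k12 H1 H2 H12 Y : C) :
  p = 1 + z -> q = 1 + w ->
  z != 0 -> w != 0 -> p != 0 -> k1 != 0 -> k2 != 0 -> k12 != 0 -> H1 != 0 -> H2 != 0 ->
  y1 != 0 -> y2 != 0 -> q != 0 ->
  y1 * k1 = H1 - p -> y2 * k2 = H2 - p -> Y * k12 = H12 - p ->
  Y = y1 * y2 * q / w ->
  let kappa1 := H1 - p * q in let kappa2 := H2 - p * q in
  H12 * (z * w * p * q - kappa1 * kappa2) = z * w * H1 * H2 ->
  let s1 := p / (z * k1) - y1 / (z * w) in
  let s2 := p / (z * k2) - y2 / (z * w) in
  let s12 := p / (z * k12) - Y / (z * w) in
  s12 = s1 * (s2 * (z - w) + q / w * y2) + s2 * (q / w * y1) <->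
  kappa1 * kappa2 = 0.
Proof.
move=> pE qE z0 w0 p0 k10 k20 k120 H10 H20 y10 y20 q0 e1 e2 e12 YE kappa1 kappa2 HE s1 s2 s12.
set D := _ - _ in HE.
have D0 : D != 0.
  apply: contra_neq (mulf_neq0 (mulf_neq0 (mulf_neq0 z0 w0) H10) H20) => D0.
  by rewrite -HE D0 mulr0.
have Y0 : Y != 0 by rewrite YE !mulf_neq0 // invr_neq0.
(* The relation for [H12] makes [M] a polynomial in the data of the two factors, so replacing [k12]
   by [M] eliminates the product pair. *)
set M := D * (Y * k12); have M0 : M != 0 by rewrite !mulf_neq0.
have ME : M = z * w * H1 * H2 - p * D by rewrite /M e12 -HE; ring.
have s12E : s12 = p * Y * D / (z * M) - Y / (z * w).
  by rewrite /s12 /M; field; rewrite z0 w0 k120 Y0 D0.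
set r := _ + s2 * _.
have key : (s12 - r) * (z ^+ 2 * w ^+ 2 * k1 * k2 * M) = - (w * p * (kappa1 * kappa2) * D).
  have -> : (s12 - r) * (z ^+ 2 * w ^+ 2 * k1 * k2 * M) =
     p * (y1 * y2 * q) * D * z * w * k1 * k2 - (y1 * y2 * q) * z * k1 * k2 * M -
     M * ((z - w) * (p * w - y1 * k1) * (p * w - y2 * k2) +
       z * q * ((p * w - y1 * k1) * (y2 * k2) + (p * w - y2 * k2) * (y1 * k1))).
    by rewrite s12E /r /s1 /s2 YE; field; rewrite z0 w0 k10 k20 M0.
  have h1 : H1 = y1 * k1 + p by rewrite e1 subrK.
  have h2 : H2 = y2 * k2 + p by rewrite e2 subrK.
  by rewrite ME /D /kappa1 /kappa2 h1 h2 pE qE; ring.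
have N0 : z ^+ 2 * w ^+ 2 * k1 * k2 * M != 0 by rewrite !mulf_neq0 ?expf_neq0.
split=> h.
  move: key; rewrite h subrr mul0r => /esym/eqP; rewrite oppr_eq0 mulf_eq0 (negbTE D0) orbF.
  by rewrite mulf_eq0 (negbTE (mulf_neq0 w0 p0)) => /eqP.
apply/eqP; rewrite -subr_eq0; move/eqP: key.
by rewrite h mulr0 mul0r oppr0 mulf_eq0 (negbTE N0) orbF.
Qed.

Lemma partial_S_eq1 (z w H : C) : z != 0 -> w != 0 -> H != 0 -> 1 + z + w != 0 ->
  (z + 1) / z * ((w + 1) / w) * (1 - (1 + z + w) / H) = 1 <->
  H - (1 + z) * (1 + w) = 0.
Proof.
move=> z0 w0 H0 t0.
have key : ((z + 1) / z * ((w + 1) / w) * (1 - (1 + z + w) / H) - 1) * (z * w * H) =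
   (1 + z + w) * (H - (1 + z) * (1 + w)) by field; rewrite z0 w0 H0.
split=> h.
  by move/eqP: key; rewrite h subrr mul0r eq_sym mulf_eq0 (negbTE t0) => /eqP.
apply/eqP; rewrite -subr_eq0; move/eqP: key.
by rewrite h mulr0 mulf_eq0 (negbTE (mulf_neq0 (mulf_neq0 z0 w0) H0)) orbF.
Qed.

End ScalarIdentity.

(** * Zeros of the two-variable moment gap *)

Section Nonvanishing.
Variables (C : numClosedFieldType) (A : vonNeumannAlgebra C).
Hypothesis C_pow2 : pow2_small C.

Section OneVariable.
Variables (f : A -> C) (K : C) (K0 : 0 <= K).
Hypothesis f_lin : forall c x y, f (c *: x + y) = c * f x + f y.
Hypothesis f_bound : forall x k, opbound x k -> `|f x| <= K * k.

Let f0 : f 0 = 0.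
Proof. by have := f_lin (-1) 0 0; rewrite scaler0 addr0 mulN1r addNr. Qed.
Let fZ c x : f (c *: x) = c * f x.
Proof. by rewrite -[c *: x]addr0 f_lin f0 addr0. Qed.
Let fD x y : f (x + y) = f x + f y.
Proof. by rewrite -[x]scale1r f_lin mul1r scale1r. Qed.

Lemma resolvent_functional_eq0 (b : A) y : (forall n, f (b ^+ n) = 0) ->
  opbound (y *: b) 2^-1 -> f (resolvent b y) = 0.
Proof.
move=> h hb; have [hQ _] := resolventP C_pow2 hb.
apply: (closure_of_eq0 K0 _ f_bound (S := [set v | f v = 0])) => //.
  by move=> u v; rewrite -scaleN1r fD fZ mulN1r.
rewrite -[resolvent b y]mul1r; apply: (neumann_closure C_pow2 hb hQ) => //=.
  by move=> u v hu hv; rewrite fD hu hv addr0.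
by move=> k; rewrite mul1r exprZn fZ h mulr0.
Qed.

(** Let [m] be the first exponent with a nonzero value. Then [f (resolvent b y)] is [y^m] times
    [f (b^m)] plus an error of order [y], which cannot vanish for small nonzero [y]. *)
Lemma resolvent_functional_neq0 (b : A) n : f (b ^+ n) != 0 ->
  exists2 d, 0 < d & forall y, `|y| < d -> y != 0 -> f (resolvent b y) != 0.
Proof.
move=> hn; have [|m hm hmin] := @ex_minnP (fun n => f (b ^+ n) != 0); first by exists n.
have [k hk] := opbound_ex (b ^+ m * b).
have L0 : 0 <= K * (k * 2) by rewrite mulr_ge0 // mulr_ge0 ?hk.1.
have L1 : 0 < K * (k * 2) + 1 by rewrite ltr_wpDl.
have c0 : 0 < `|f (b ^+ m)| by rewrite normr_gt0.
have h2 : (0 : C) < 2^-1 by rewrite invr_gt0 ltr0n.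
have [d1 d10 hd1] := opbound_near b h2.
have [d d0 [dd1 dd2]] := exists_pos_lower d10 (divr_gt0 c0 L1).
exists d => // y hy y0.
have hb := hd1 y (le_trans (ltW hy) dd1); have [hQ bQ] := resolventP C_pow2 hb.
have fQ : f (resolvent b y) = y ^+ m * (f (b ^+ m) + y * f (b ^+ m * b * resolvent b y)).
  have QE : resolvent b y = (y *: b) ^+ m * resolvent b y + \sum_(i < m) (y *: b) ^+ i.
    by rewrite -(inv_sub_geometric m hQ) subrK.
  rewrite [in LHS]QE fD [X in _ + X](_ : _ = 0) ?addr0.
    rewrite exprZn -scalerAl fZ; congr (_ * _).
    have RE : resolvent b y = 1 + y *: (b * resolvent b y).
      by rewrite -(resolvent_sub1 C_pow2 hb).1 addrC subrK.
    by rewrite {1}RE mulrDr mulr1 fD -scalerAr fZ mulrA.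
  have : forall i : 'I_m, f ((y *: b) ^+ i) = 0.
    move=> i; rewrite exprZn fZ; have [->|/hmin] := eqVneq (f (b ^+ i)) 0.
      by rewrite mulr0.
    by rewrite leqNgt ltn_ord.
  by move=> hi; elim/big_ind: _ => // u v hu hv; rewrite fD hu hv addr0.
rewrite fQ mulf_neq0 ?expf_neq0 //; apply/eqP => /eqP; rewrite addr_eq0 => /eqP e.
have : `|f (b ^+ m)| < `|f (b ^+ m)|.
  rewrite {1}e normrN normrM.
  apply: (@le_lt_trans _ _ (`|y| * (K * (k * 2)))).
    by rewrite ler_wpM2l // f_bound //; exact: opboundM.
  apply: (@le_lt_trans _ _ (`|y| * (K * (k * 2) + 1))).
    by rewrite ler_wpM2l // lerDl ler01.
  by rewrite -ltr_pdivlMr //; exact: lt_le_trans dd2.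
by rewrite ltxx.
Qed.

End OneVariable.

Variable phi : {scalar A}.
Hypothesis phi_state : is_state phi.

(** The covariance [fl] is bilinear and bounded. If it vanishes on all pairs of powers, it vanishes
    on resolvents. Otherwise the leading coefficient argument is applied to [b] with a power of [a]
    fixed, then to [a] with the resolvent of [b] fixed, so [e] depends on [y]. *)
Lemma resolvent_factor_or_neq (a b : A) :
  (forall x y, opbound (x *: a) 2^-1 -> opbound (y *: b) 2^-1 ->
     phi (resolvent a x * resolvent b y) = phi (resolvent a x) * phi (resolvent b y)) \/
  (exists2 d, 0 < d & forall y, `|y| < d -> y != 0 ->
     exists2 e, 0 < e & forall x, `|x| < e -> x != 0 ->
       phi (resolvent a x * resolvent b y) != phi (resolvent a x) * phi (resolvent b y)).
Proof.
pose fl u v := phi (u * v) - phi u * phi v.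
have phiP c x y : phi (c *: x + y) = c * phi x + phi y by exact: linearP.
have fl_linl v c x y : fl (c *: x + y) v = c * fl x v + fl y v.
  by rewrite /fl mulrDl -scalerAl !phiP; ring.
have fl_linr v c x y : fl v (c *: x + y) = c * fl v x + fl v y.
  by rewrite /fl mulrDr -scalerAr !phiP; ring.
have bnd u k : opbound u k -> `|phi u| <= k by exact: state_opbound.
have fl_bound u k v l : opbound u k -> opbound v l -> `|fl u v| <= 2 * k * l.
  move=> hu hv; apply: le_trans (ler_normB _ _) _; rewrite -mulrA [2 * _]mulrDl !mul1r normrM.
  rewrite lerD //; first exact: bnd (opboundM hu hv).
  by apply: ler_pM => //; exact: bnd.
have [hz|[m [n hmn]]] : (forall m n, fl (a ^+ m) (b ^+ n) = 0) \/
    exists m n, fl (a ^+ m) (b ^+ n) != 0.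
  have [h|h] := pselect (exists m n, fl (a ^+ m) (b ^+ n) != 0); first by right.
  left=> m n; apply/eqP/negPn/negP => hmn; apply: h; by exists m, n.
- left=> x y hx hy; apply/eqP; rewrite -subr_eq0; apply/eqP.
  have [l hl] := opbound_ex (resolvent b y).
  apply: (@resolvent_functional_eq0 (fun u => fl u (resolvent b y)) (2 * l)) => //.
  - by rewrite mulr_ge0 ?hl.1.
  - by move=> u k hu; apply: le_trans (fl_bound _ _ _ _ hu hl) _; rewrite mulrAC.
  move=> m; have [k hk] := opbound_ex (a ^+ m).
  apply: (@resolvent_functional_eq0 (fl (a ^+ m)) (2 * k)) => //.
  - by rewrite mulr_ge0 ?hk.1.
  - by move=> v l' hv; exact: fl_bound.
- right; have [k hk] := opbound_ex (a ^+ m).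
  have [d d0 hd] := @resolvent_functional_neq0 (fl (a ^+ m)) (2 * k)
    (mulr_ge0 (ler0n _ _) hk.1) (fl_linr _) (fun v l hv => fl_bound _ _ _ _ hk hv) b n hmn.
  exists d => // y hy y0; have [l hl] := opbound_ex (resolvent b y).
  have fl_bound_l u j : opbound u j -> `|fl u (resolvent b y)| <= 2 * l * j.
    by move=> hu; apply: le_trans (fl_bound _ _ _ _ hu hl) _; rewrite mulrAC.
  have [e e0 he] := @resolvent_functional_neq0 (fun u => fl u (resolvent b y)) (2 * l)
    (mulr_ge0 (ler0n _ _) hl.1) (fl_linl _)
    fl_bound_l a m (hd y hy y0).
  by exists e => // x hx x0; rewrite -subr_eq0; exact: he.
Qed.

End Nonvanishing.

(** * Inverse moment series of the product pair *)

Section Product.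
Variables (C : numClosedFieldType) (A : vonNeumannAlgebra C).
Hypothesis C_pow2 : pow2_small C.
Hypothesis C_complete : @geometric_complete C C.
Variable phi : {scalar A}.
Hypothesis phi_state : is_state phi.

Lemma add1_bound (z : C) : `|z| <= 2^-1 -> 1 + z != 0 /\ 2^-1 <= `|1 + z| <= 2.
Proof.
move=> hz; have hh : (1 : C) = 2^-1 + 2^-1 by rewrite [LHS]splitr !mul1r.
have h2 : (0 : C) < 2^-1 by rewrite invr_gt0 ltr0n.
have lo : 2^-1 <= `|1 + z|.
  rewrite -(lerD2r 2^-1) -hh -[leLHS]normr1.
  rewrite -{1}(addrK z 1); apply: le_trans (ler_normB _ _) _.
  by rewrite lerD2l.
split; first by rewrite -normr_gt0 (lt_le_trans h2).
rewrite lo /=; apply: le_trans (ler_normD _ _) _; rewrite normr1.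
by rewrite -[2]/(1 + 1) lerD2l (le_trans hz) // invf_le1 ?ltr0n // ler1n.
Qed.

(** Both [x_j] and [R_j - (1 + z) = x_j a_j R_j - z] are of order [z], so each product of two of
    them is of order [z^2] and survives the division by [z]. *)
Lemma product_resolvent_near (a : bool -> A) (e : C) : 0 < e ->
  (forall i, phi (a i) != 0) ->
  exists2 d, 0 < d & forall z, `|z| < d -> z != 0 ->
    let x i := Psi_inv phi (a i) z in
    let rho := x false * x true * (1 + z) / z in
    [/\ opbound ((z * (1 + z))^-1 *: ((resolvent (a false) (x false) - (1 + z)%:A) *
          (resolvent (a true) (x true) - (1 + z)%:A))) 2^-1,
        opbound (rho *: (a false * a true)) 2^-1 & `|rho| < e].
Proof.
move=> e0 a0.
have [K K0 [d1 d10 h1]] : exists2 K, 0 < K & exists2 d, 0 < d & forall i z, `|z| < d ->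
    let x := Psi_inv phi (a i) z in
    [/\ opbound (x *: a i) 2^-1, opbound (resolvent (a i) x - (1 + z)%:A) (K * `|z|) &
      `|x| <= K * `|z|].
  have hi i : exists2 K, 0 < K & exists2 d, 0 < d & forall z, `|z| < d ->
      let x := Psi_inv phi (a i) z in
      [/\ opbound (x *: a i) 2^-1, opbound (resolvent (a i) x - (1 + z)%:A) (K * `|z|) &
        `|x| <= K * `|z|].
    have [K K0 [d d0 hd]] := Psi_inv_near C_pow2 phi_state C_complete (a0 i).
    have [k [k0 hk]] := opbound_ex (a i).
    have Kk : 0 <= K * (k * 2) by rewrite mulr_ge0 ?(ltW K0) // mulr_ge0.
    exists (K + (K * (k * 2) + 1)); first by rewrite addr_gt0 // ltr_wpDl.
    exists d => // z hz x; have [bx _ xK] := hd z hz; split=> //; last first.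
      by apply: le_trans xK _; rewrite ler_wpM2r // lerDl addr_ge0.
    have [_ bR] := resolventP C_pow2 bx.
    have -> : resolvent (a i) x - (1 + z)%:A = x *: (a i * resolvent (a i) x) - z%:A.
      by rewrite scalerDl scale1r opprD addrA (resolvent_sub1 C_pow2 bx).1.
    apply: opbound_le (opboundB (opboundZ x (opboundM (conj k0 hk) bR)) (opbound_alg A z)) _.
    apply: (@le_trans _ _ (K * `|z| * (k * 2) + `|z|)).
      by rewrite lerD2r ler_wpM2r // mulr_ge0.
    rewrite mulrDl mulrDl mul1r addrA lerD2r mulrAC lerDr mulr_ge0 // ltW //.
  have [K1 K10 [d1 d10 h1]] := hi false; have [K2 K20 [d2 d20 h2]] := hi true.
  have [d d0 [dd1 dd2]] := exists_pos_lower d10 d20.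
  exists (K1 + K2); first exact: addr_gt0.
  exists d => // -[] z hz x.
    have [bx bR xK] := h2 z (lt_le_trans hz dd2).
    have KK : K2 * `|z| <= (K1 + K2) * `|z| by rewrite ler_wpM2r // lerDr ltW.
    by split=> //; [exact: opbound_le KK | exact: le_trans KK].
  have [bx bR xK] := h1 z (lt_le_trans hz dd1).
  have KK : K1 * `|z| <= (K1 + K2) * `|z| by rewrite ler_wpM2r // lerDl ltW.
  by split=> //; [exact: opbound_le KK | exact: le_trans KK].
have h2 : (0 : C) < 2^-1 by rewrite invr_gt0 ltr0n.
have [t t0 ht] := opbound_near (a false * a true) h2.
have [e1 e10 [e1e e1t]] := exists_pos_lower e0 t0.
(* As [1 + z] has modulus between [2^-1] and 2, the same constant [2 K^2] controls [rho] and the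
   product of the two centered resolvents. *)
have K2 : 0 < 2 * (K * K) by rewrite mulr_gt0 ?ltr0n // mulr_gt0.
have [d2 d20 [d22 d2e]] := exists_pos_lower h2 (divr_gt0 e10 K2).
have [d3 d30 [d32 d3h]] := exists_pos_lower d20 (divr_gt0 h2 K2).
have [d d0 [dd1 dd3]] := exists_pos_lower d10 d30.
exists d => // z hz z0 x rho.
have z_gt0 : 0 < `|z| by rewrite normr_gt0.
have [bx1 bR1 xK1] := h1 false z (lt_le_trans hz dd1).
have [bx2 bR2 xK2] := h1 true z (lt_le_trans hz dd1).
have hz3 := lt_le_trans hz dd3; have hz2 := lt_le_trans hz3 d32.
have [p0 /andP[p_lo p_hi]] := add1_bound (ltW (lt_le_trans hz2 d22)).
have p_gt0 : 0 < `|1 + z| by rewrite normr_gt0.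
have rho_lt : `|rho| < e1.
  apply: (@le_lt_trans _ _ (2 * (K * K) * `|z|)); last first.
    by rewrite mulrC -ltr_pdivlMr //; exact: lt_le_trans d2e.
  rewrite /rho !normrM normfV ler_pdivrMr //.
  apply: (@le_trans _ _ (K * `|z| * (K * `|z|) * 2)).
    by rewrite ler_pM ?mulr_ge0 // ler_pM.
  by rewrite le_eqVlt; apply/orP; left; apply/eqP; ring.
split; last exact: lt_le_trans e1e.
- apply: opbound_le (opboundZ _ (opboundM bR1 bR2)) _.
  rewrite normfV normrM mulrC ler_pdivrMr ?mulr_gt0 //.
  apply: (@le_trans _ _ (2^-1 * (`|z| * 2^-1))); last by rewrite !ler_wpM2l ?(ltW h2).
  have -> : K * `|z| * (K * `|z|) = 2^-1 * (`|z| * (`|z| * (2 * (K * K)))) by field.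
  rewrite !ler_wpM2l ?(ltW h2) // -ler_pdivlMr //.
  exact: ltW (lt_le_trans hz3 d3h).
- by apply: ht; exact: le_trans (ltW rho_lt) e1t.
Qed.

Variables a b : bool -> A.
Hypothesis ab_bifree : bifree phi (a false) (b false) (a true) (b true).

Lemma poly_closure_shift (e : A) c : poly_closure e (e - c%:A).
Proof.
apply: closure_of_sub; exists ('X - c%:P) => //.
by rewrite rmorphB /= horner_algX horner_algC.
Qed.

(** One-letter centered words, with 1 as the word on the other side. This makes the means of the
    product pair nonzero, so that its transforms are defined. *)
Lemma bifree_phi_mul : phi (a false * a true) = phi (a false) * phi (a true) /\
  phi (b false * b true) = phi (b false) * phi (b true).
Proof.
have phiP c x y : phi (c *: x + y) = c * phi x + phi y by exact: linearP.
have c0 e : phi (e - (phi e)%:A) = 0.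
  by rewrite linearB linearZ /= (state1 phi_state) mulr1 subrr.
have w1 (c : bool -> A) : word_closure phi c true (c false - (phi (c false))%:A).
  have := word_closure_mul phi_state (word_closure1 phi c false)
    (poly_closure_shift (c false) (phi (c false))) (c0 _).
  by rewrite mul1r.
have expand (c1 c2 : A) : phi ((c1 - (phi c1)%:A) * (c2 - (phi c2)%:A)) = 0 ->
    phi (c1 * c2) = phi c1 * phi c2.
  have : c1 = (phi c1)%:A + (c1 - (phi c1)%:A) by rewrite addrC subrK.
  have : c2 = (phi c2)%:A + (c2 - (phi c2)%:A) by rewrite addrC subrK.
  move: (phi c1) (phi c2) (c1 - _) (c2 - _) (c0 c1) (c0 c2) => k l u v u0 v0 -> -> h.
  rewrite !(mulrDl, mulrDr) !(mulr_algl, mulr_algr).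
  rewrite ![in LHS](linearD, linearZ) /= (state1 phi_state) u0 v0 h; ring.
split; apply: expand.
  have [h _ _] := bifree_word_closure phi_state ab_bifree (w1 a) (word_closure1 phi b true)
    (poly_closure_shift (a true) (phi (a true))) (c0 _)
    (poly_closure_shift (b true) (phi (b true))) (c0 _).
  by rewrite -[RHS]h mulr1.
have [_ h _] := bifree_word_closure phi_state ab_bifree (word_closure1 phi a true) (w1 b)
  (poly_closure_shift (a true) (phi (a true))) (c0 _)
  (poly_closure_shift (b true) (phi (b true))) (c0 _).
by rewrite -[RHS]h mul1r.
Qed.

(** The resolvent of [a_1 a_2] at [rho] has moment [p], that is, [Psi] takes the value [z] at [rho].
    As [rho] is small, the local left inverse identifies it with [Psi_inv] at [z]. *)
Lemma Psi_inv_product_near :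
  (forall i, phi (a i) != 0) -> (forall i, phi (b i) != 0) ->
  exists2 d, 0 < d & forall z w, `|z| < d -> `|w| < d -> z != 0 -> w != 0 ->
    let x i := Psi_inv phi (a i) z in let y i := Psi_inv phi (b i) w in
    let X := Psi_inv phi (a false * a true) z in
    let Y := Psi_inv phi (b false * b true) w in
    let H i := phi (resolvent (a i) (x i) * resolvent (b i) (y i)) in
    let p := 1 + z in let q := 1 + w in
    [/\ X = x false * x true * p / z, Y = y false * y true * q / w &
      phi (resolvent (a false * a true) X * resolvent (b false * b true) Y) *
        (z * w * p * q - (H false - p * q) * (H true - p * q)) =
      z * w * H false * H true].
Proof.
move=> a0 b0; have [abE bbE] := bifree_phi_mul.
have ab0 : phi (a false * a true) != 0 by rewrite abE mulf_neq0.
have bb0 : phi (b false * b true) != 0 by rewrite bbE mulf_neq0.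
have [_ /near0_normP [ea ea0 inva] _] := Psi_inv_is_comp_inverse C_pow2 phi_state C_complete ab0.
have [_ /near0_normP [eb eb0 invb] _] := Psi_inv_is_comp_inverse C_pow2 phi_state C_complete bb0.
have [da da0 ha] := product_resolvent_near ea0 a0.
have [db db0 hb] := product_resolvent_near eb0 b0.
have [K0 _ [d0 d00 h0]] := Psi_inv_pair C_pow2 phi_state C_complete (a0 false) (b0 false).
have [K1 _ [d1 d10 h1]] := Psi_inv_pair C_pow2 phi_state C_complete (a0 true) (b0 true).
have h2 : (0 : C) < 2^-1 by rewrite invr_gt0 ltr0n.
have [t1 t10 [t1a t1b]] := exists_pos_lower da0 db0.
have [t2 t20 [t20' t21]] := exists_pos_lower d00 d10.
have [t3 t30 [t31 t32]] := exists_pos_lower t10 t20.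
have [d d_gt0 [dt3 dh]] := exists_pos_lower t30 h2.
exists d => // z w hz hw z0 w0 x y X Y H p q.
have [ra1 ra2 ra3] := ha z (lt_le_trans hz (le_trans dt3 (le_trans t31 t1a))) z0.
have [rb1 rb2 rb3] := hb w (lt_le_trans hw (le_trans dt3 (le_trans t31 t1b))) w0.
have dd0 : d <= d0 := le_trans dt3 (le_trans t32 t20').
have dd1 : d <= d1 := le_trans dt3 (le_trans t32 t21).
have [[xf yf] [fxf fyf] _ _] := h0 z w (lt_le_trans hz dd0) (lt_le_trans hw dd0).
have [[xt yt] [fxt fyt] _ _] := h1 z w (lt_le_trans hz dd1) (lt_le_trans hw dd1).
have [p0 _] := add1_bound (ltW (lt_le_trans hz dh)).
have [q0 _] := add1_bound (ltW (lt_le_trans hw dh)).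
have bx i : opbound (x i *: a i) 2^-1 by case: i.
have b_y i : opbound (y i *: b i) 2^-1 by case: i.
have fx i : phi (resolvent (a i) (x i)) = p by case: i.
have fy i : phi (resolvent (b i) (y i)) = q by case: i.
have [pL pK pLK] := bifree_product_resolvents C_pow2 phi_state ab_bifree z0 p0 erefl w0 q0 erefl
  bx (fun i => (resolventP C_pow2 (bx i)).1) fx b_y (fun i => (resolventP C_pow2 (b_y i)).1) fy
  ra1 rb1 (resolventP C_pow2 ra2).1 (resolventP C_pow2 rb2).1.
have XE : X = x false * x true * p / z.
  rewrite -[RHS]inva // PsiE // pL /X; congr (Psi_inv _ _ _).
  by rewrite /p addrAC subrr add0r.
have YE : Y = y false * y true * q / w.
  rewrite -[RHS]invb // PsiE // pK /Y; congr (Psi_inv _ _ _).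
  by rewrite /q addrAC subrr add0r.
by split=> //; rewrite XE YE; exact: pLK.
Qed.

End Product.

(** * The matrix identity in terms of the moment gaps *)

Section Identity.
Variables (C : numClosedFieldType) (A : vonNeumannAlgebra C).
Hypothesis C_pow2 : pow2_small C.
Hypothesis C_complete : @geometric_complete C C.
Variable phi : {scalar A}.
Hypothesis phi_state : is_state phi.

(** The quantity [k_j] of the overview, for one pair. *)
Definition moment_gap (a b : A) (z w : C) : C :=
  phi (resolvent a (Psi_inv phi a z) * resolvent b (Psi_inv phi b w)) - (1 + z) * (1 + w).

Lemma moment_neq0_near (a b : A) : phi a != 0 -> phi b != 0 ->
  exists2 d, 0 < d & forall z w, `|z| < d -> `|w| < d ->
    phi (resolvent a (Psi_inv phi a z) * resolvent b (Psi_inv phi b w)) != 0.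
Proof.
move=> a0 b0.
have h2 : (0 : C) < 2^-1 by rewrite invr_gt0 ltr0n.
have [t t0 ht] := resolvent_product_near C_pow2 phi_state a 1 b h2.
have [K K0 [d1 d10 h1]] := Psi_inv_pair C_pow2 phi_state C_complete a0 b0.
have [d d0 [dd1 dt]] := exists_pos_lower d10 (divr_gt0 t0 K0).
exists d => // z w hz hw.
have [_ _ [xK yK] _] := h1 z w (lt_le_trans hz dd1) (lt_le_trans hw dd1).
have xt : `|Psi_inv phi a z| <= t.
  apply: le_trans xK _; rewrite mulrC -ler_pdivlMr //.
  exact: le_trans (ltW hz) dt.
have yt : `|Psi_inv phi b w| <= t.
  apply: le_trans yK _; rewrite mulrC -ler_pdivlMr //.
  exact: le_trans (ltW hw) dt.
have [_ _] := ht _ _ xt yt.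
rewrite mulr1 (state1 phi_state) => h; apply/eqP => H0; move: h.
by rewrite H0 sub0r normrN normr1 lt_geF // invf_lt1 ?ltr0n // ltr1n.
Qed.

Lemma Spartial_eq1_near (a b : A) : phi a != 0 -> phi b != 0 ->
  exists2 d, 0 < d & forall z w, `|z| < d -> `|w| < d -> z != 0 -> w != 0 ->
    Spartial phi a b z w = 1 <-> moment_gap a b z w = 0.
Proof.
move=> a0 b0.
(* With both variables below [1 / 4], the factor [1 + z + w] of the S-transform is nonzero. *)
have h4 : (0 : C) < 2^-1 / 2 by rewrite divr_gt0 ?invr_gt0 ?ltr0n.
have [d1 d10 h1] := moment_neq0_near a0 b0.
have [K K0 [d2 d20 h2]] := Psi_inv_pair C_pow2 phi_state C_complete a0 b0.
have [t t0 [td1 td2]] := exists_pos_lower d10 d20.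
have [d d0 [dt d4]] := exists_pos_lower t0 h4.
exists d => // z w hz hw z0 w0.
have H0 := h1 z w (lt_le_trans hz (le_trans dt td1)) (lt_le_trans hw (le_trans dt td1)).
have [[bx b_y] _ _ _] := h2 z w (lt_le_trans hz (le_trans dt td2))
  (lt_le_trans hw (le_trans dt td2)).
rewrite /Spartial HseriesE //; apply: partial_S_eq1 => //.
rewrite -addrA; apply: (add1_bound _).1; apply: le_trans (ler_normD _ _) _.
rewrite (splitr 2^-1) lerD //; first exact: le_trans (ltW hz) d4.
exact: le_trans (ltW hw) d4.
Qed.

Variables a b : bool -> A.
Hypothesis ab_bifree : bifree phi (a false) (b false) (a true) (b true).
Hypothesis a0 : forall i, phi (a i) != 0.
Hypothesis b0 : forall i, phi (b i) != 0.
Let X i := diag2 (a i) (b i).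

Definition SM_identity (G : 'M[C]_2) : Prop :=
  SM phi (X false *m X true) G = SM phi (X true) G *m
    SM phi (X false) (invmx (SM phi (X true) G) *m G *m SM phi (X true) G).

Lemma Psi_inv_neq0 (c : A) z : phi (resolvent c (Psi_inv phi c z)) = 1 + z ->
  z != 0 -> Psi_inv phi c z != 0.
Proof.
move=> h z0; apply: contra z0 => /eqP x0; move: h.
rewrite x0 resolvent0 (state1 phi_state) -{1}[1]addr0 => /addrI <-.
exact: eqxx.
Qed.

Lemma upper2_inj u v w u' v' w' : @upper2 C u v w = upper2 u' v' w' ->
  [/\ u = u', v = v' & w = w'].
Proof.
move=> h; have [e1 e2 _ e3] := upper2E u v w; have [f1 f2 _ f3] := upper2E u' v' w'.
by split; [rewrite -e1 h f1 | rewrite -e2 h f2 | rewrite -e3 h f3].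
Qed.

Lemma SM_identity_near :
  exists2 d, 0 < d & forall z zeta w, `|z| < d -> `|w| < d -> z != 0 -> w != 0 ->
    SM_identity (upper2 z zeta w) <->
    zeta * (moment_gap (a false) (b false) z w * moment_gap (a true) (b true) z w) = 0.
Proof.
have [abE bbE] := bifree_phi_mul phi_state ab_bifree.
have ab0 : phi (a false * a true) != 0 by rewrite abE mulf_neq0.
have bb0 : phi (b false * b true) != 0 by rewrite bbE mulf_neq0.
have [d1 d10 S1] := SM_E C_pow2 phi_state C_complete (a0 false) (b0 false).
have [d2 d20 S2] := SM_E C_pow2 phi_state C_complete (a0 true) (b0 true).
have [d3 d30 S12] := SM_E C_pow2 phi_state C_complete ab0 bb0.
have [K1 _ [d4 d40 P1]] := Psi_inv_pair C_pow2 phi_state C_complete (a0 false) (b0 false).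
have [K2 _ [d5 d50 P2]] := Psi_inv_pair C_pow2 phi_state C_complete (a0 true) (b0 true).
have [K3 _ [d6 d60 P12]] := Psi_inv_pair C_pow2 phi_state C_complete ab0 bb0.
have [d7 d70 N1] := moment_neq0_near (a0 false) (b0 false).
have [d8 d80 N2] := moment_neq0_near (a0 true) (b0 true).
have [d9 d90 HP] := Psi_inv_product_near C_pow2 C_complete phi_state ab_bifree a0 b0.
have h2 : (0 : C) < 2^-1 by rewrite invr_gt0 ltr0n.
have [e1 e10 [e1l e1r]] := exists_pos_lower d10 d20.
have [e2 e20 [e2l e2r]] := exists_pos_lower d30 e10.
have [e3 e30 [e3l e3r]] := exists_pos_lower d40 e20.
have [e4 e40 [e4l e4r]] := exists_pos_lower d50 e30.
have [e5 e50 [e5l e5r]] := exists_pos_lower d60 e40.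
have [e6 e60 [e6l e6r]] := exists_pos_lower d70 e50.
have [e7 e70 [e7l e7r]] := exists_pos_lower d80 e60.
have [e8 e80 [e8l e8r]] := exists_pos_lower d90 e70.
have [e9 e90 [e9l e9r]] := exists_pos_lower h2 e80.
have up t (s : C) : `|s| < e9 -> e9 <= t -> `|s| < t by move=> h /(lt_le_trans h).
exists e9 => // z zeta w hz hw z0 w0.
have E8 := e9r; have E7 := le_trans E8 e8r; have E6 := le_trans E7 e7r.
have E5 := le_trans E6 e6r; have E4 := le_trans E5 e5r; have E3 := le_trans E4 e4r.
have E2 := le_trans E3 e3r; have E1 := le_trans E2 e2r.
have D1 := le_trans E1 e1l; have D2 := le_trans E1 e1r; have D3 := le_trans E2 e2l.
have D4 := le_trans E3 e3l; have D5 := le_trans E4 e4l; have D6 := le_trans E5 e5l.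
have D7 := le_trans E6 e6l; have D8 := le_trans E7 e7l; have D9 := le_trans E8 e8l.
(* The off-diagonal entry is left free: conjugation by the transform of [X true] keeps the diagonal
   of the argument but changes this entry without control of its size. *)
have {}S1 u := S1 z u w (up _ _ hz D1) (up _ _ hw D1) z0 w0.
have {}S2 := S2 z zeta w (up _ _ hz D2) (up _ _ hw D2) z0 w0.
have {}S12 := S12 z zeta w (up _ _ hz D3) (up _ _ hw D3) z0 w0.
have {P1}[[bx1 by1] [fx1 fy1] _ k1] := P1 z w (up _ _ hz D4) (up _ _ hw D4).
have {P2}[[bx2 by2] [fx2 fy2] _ k2] := P2 z w (up _ _ hz D5) (up _ _ hw D5).
have {P12}[[bx12 by12] [fx12 fy12] _ k12] := P12 z w (up _ _ hz D6) (up _ _ hw D6).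
have {}N1 := N1 z w (up _ _ hz D7) (up _ _ hw D7).
have {}N2 := N2 z w (up _ _ hz D8) (up _ _ hw D8).
have {HP}[XE YE HE] := HP z w (up _ _ hz D9) (up _ _ hw D9) z0 w0.
have [p0 _] := add1_bound (ltW (up _ _ hz e9l)).
have [q0 _] := add1_bound (ltW (up _ _ hw e9l)).
have x1_0 := Psi_inv_neq0 fx1 z0; have x2_0 := Psi_inv_neq0 fx2 z0.
have y1_0 := Psi_inv_neq0 fy1 w0; have y2_0 := Psi_inv_neq0 fy2 w0.
have i1 := off_diagE C_pow2 phi (a false) (Psi_inv phi (a false) z) by1; rewrite fx1 in i1.
have i2 := off_diagE C_pow2 phi (a true) (Psi_inv phi (a true) z) by2; rewrite fx2 in i2.
have i12 := off_diagE C_pow2 phi (a false * a true) (Psi_inv phi (a false * a true) z) by12.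
rewrite fx12 in i12.
have key := off_diag_identity erefl erefl z0 w0 p0 k1 k2 k12 N1 N2 y1_0 y2_0 q0
  i1 i2 i12 YE HE; cbv zeta in key.
rewrite /SM_identity /X diag2_mul S12 S2.
set x1 := Psi_inv phi (a false) z in key S1 XE x1_0 *.
set x2 := Psi_inv phi (a true) z in key S1 XE x2_0 *.
set y1 := Psi_inv phi (b false) w in key S1 YE y1_0 *.
set y2 := Psi_inv phi (b true) w in key S1 YE y2_0 *.
set s1 := (X in X * (_ + _) + _) in key.
set s2 := (X in _ + X * _) in key.
set s12 := (X in X = _) in key.
have al0 : (1 + z) / z * x2 != 0 by rewrite !mulf_neq0 // invr_neq0.
have be0 : (1 + w) / w * y2 != 0 by rewrite !mulf_neq0 // invr_neq0.
have conjE : invmx (upper2 ((1 + z) / z * x2) (zeta * s2) ((1 + w) / w * y2)) *m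
    upper2 z zeta w *m upper2 ((1 + z) / z * x2) (zeta * s2) ((1 + w) / w * y2) =
    upper2 z ((zeta * s2 * (z - w) + zeta * ((1 + w) / w * y2)) / ((1 + z) / z * x2)) w.
  rewrite (upper2_inv _ al0 be0).2 !upper2_mul.
  by congr (upper2 _ _ _); field; rewrite ?z0 ?w0 ?p0 ?q0 ?x2_0 ?y2_0.
rewrite conjE S1 upper2_mul -/s1.
have diag1 : (1 + z) / z * Psi_inv phi (a false * a true) z =
    (1 + z) / z * x2 * ((1 + z) / z * x1) by rewrite XE; field.
have diag2 : (1 + w) / w * Psi_inv phi (b false * b true) w =
    (1 + w) / w * y2 * ((1 + w) / w * y1) by rewrite YE; field.
have offE : (1 + z) / z * x2 * ((zeta * s2 * (z - w) + zeta * ((1 + w) / w * y2)) /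
      ((1 + z) / z * x2) * s1) + zeta * s2 * ((1 + w) / w * y1) =
    zeta * (s1 * (s2 * (z - w) + (1 + w) / w * y2) + s2 * ((1 + w) / w * y1)).
  by field; rewrite ?z0 ?w0 ?p0 ?q0 ?x2_0 ?y2_0.
rewrite diag1 diag2 offE -/s12.
(* Both sides are now upper triangular with the same diagonal and off-diagonal entries proportional
   to [zeta]; a diagonal argument gives no condition. *)
have [zeta0|zeta0] := eqVneq zeta 0; first by rewrite zeta0 !mul0r.
split.
  move=> /upper2_inj [_ /(mulfI zeta0) /key h _].
  by rewrite /moment_gap h mulr0.
by move=> /eqP; rewrite mulf_eq0 (negbTE zeta0) => /eqP /key ->.
Qed.

End Identity.

(** * From a vanishing product to a vanishing factor *)

Section Equivalence.
Variables (C : numClosedFieldType) (A : vonNeumannAlgebra C).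
Hypothesis C_pow2 : pow2_small C.
Hypothesis C_complete : @geometric_complete C C.
Variable phi : {scalar A}.
Hypothesis phi_state : is_state phi.

Lemma near_matrix0P (P : 'M[C]_2 -> Prop) : (\forall G \near (0 : 'M[C]_2), P G) <->
  exists2 d, 0 < d & forall G : 'M[C]_2, (forall i j, `|G i j| < d) -> P G.
Proof.
split=> [/nbhs_ballP [d /= d0 h]|[d d0 h]].
  exists d => // G hG; apply: h; split=> // i j.
  by rewrite -ball_normE /= mxE sub0r normrN.
apply/nbhs_ballP; exists d => // G [_ hG]; apply: h => i j.
by have := hG i j; rewrite -ball_normE /= mxE sub0r normrN.
Qed.

Lemma moment_gap_alternative (a b : A) : phi a != 0 -> phi b != 0 ->
  (exists2 d, 0 < d & forall z w, `|z| < d -> `|w| < d -> moment_gap phi a b z w = 0) \/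
  (exists2 d, 0 < d & forall w, `|w| < d -> w != 0 ->
     exists2 e, 0 < e & forall z, `|z| < e -> z != 0 -> moment_gap phi a b z w != 0).
Proof.
move=> a0 b0; have [K K0 [d d0 h]] := Psi_inv_pair C_pow2 phi_state C_complete a0 b0.
have [hf|[t t0 ht]] := resolvent_factor_or_neq C_pow2 phi_state a b; [left|right].
  exists d => // z w hz hw; have [[bx b_y] [fx fy] _ _] := h z w hz hw.
  by rewrite /moment_gap hf // fx fy subrr.
have [d1 d10 [d1d d1t]] := exists_pos_lower d0 (divr_gt0 t0 K0).
exists d1 => // w hw w0; set y := Psi_inv phi b w.
have hwd := lt_le_trans hw d1d.
(* [Psi_inv_pair] treats both variables together; [z = 0] serves as a dummy to extract the facts
   about [y]. *)
have z0d : `|0 : C| < d by rewrite normr0.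
have [_ [_ fy] [_ yK] _] := h 0 w z0d hwd.
have yt : `|y| < t.
  apply: le_lt_trans yK _; rewrite mulrC -ltr_pdivlMr //.
  exact: lt_le_trans d1t.
have [e e0 he] := ht y yt (Psi_inv_neq0 phi_state fy w0).
have [e1 e10 [e1d e1e]] := exists_pos_lower d0 (divr_gt0 e0 K0).
exists e1 => // z hz z0; have [_ [fx _] [xK _] _] := h z w (lt_le_trans hz e1d) hwd.
have xe : `|Psi_inv phi a z| < e.
  apply: le_lt_trans xK _; rewrite mulrC -ltr_pdivlMr //.
  exact: lt_le_trans e1e.
have := he _ xe (Psi_inv_neq0 phi_state fx z0).
by rewrite fx fy /moment_gap subr_eq0.
Qed.

Variables a b : bool -> A.
Hypothesis ab_bifree : bifree phi (a false) (b false) (a true) (b true).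
Hypothesis a0 : forall i, phi (a i) != 0.
Hypothesis b0 : forall i, phi (b i) != 0.

Let Spartial_trivial i := \forall z \near (0 : C) & w \near (0 : C),
  z != 0 -> w != 0 -> Spartial phi (a i) (b i) z w = 1.

Lemma Spartial_trivialP i : Spartial_trivial i <->
  exists2 d, 0 < d & forall z w, `|z| < d -> `|w| < d -> z != 0 -> w != 0 ->
    moment_gap phi (a i) (b i) z w = 0.
Proof.
have [d d0 hd] := Spartial_eq1_near C_pow2 C_complete phi_state (a0 i) (b0 i).
split=> [/near2P|] [e e0 he]; last apply/near2P;
  have [t t0 [td te]] := exists_pos_lower d0 e0; exists t => // z w hz hw z0 w0.
  by apply/hd; rewrite ?he //; apply: lt_le_trans te || apply: lt_le_trans td.
by apply/hd; rewrite ?he //; apply: lt_le_trans te || apply: lt_le_trans td.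
Qed.

Theorem bifree_S_identity :
  (\forall G \near (0 : 'M[C]_2), is_upper2 G -> G \in unitmx ->
     SM_identity phi a b G) <->
  (Spartial_trivial false \/ Spartial_trivial true).
Proof.
have [d d0 hd] := SM_identity_near C_pow2 C_complete phi_state ab_bifree a0 b0.
split=> [/near_matrix0P [e e0 he]|].
  have [t t0 [td te]] := exists_pos_lower d0 e0.
  have gap z w : `|z| < t -> `|w| < t -> z != 0 -> w != 0 ->
      moment_gap phi (a false) (b false) z w * moment_gap phi (a true) (b true) z w = 0.
    move=> hz hw z0 w0.
    have /(hd _ _ _ (lt_le_trans hz td) (lt_le_trans hw td) z0 w0)/eqP :
        (* Any small nonzero off-diagonal entry would do; [z] itself is at hand. *)
        SM_identity phi a b (upper2 z z w).
      apply: he; [|exact: is_upper2_upper2|exact: (upper2_inv z z0 w0).1].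
      move=> i j; rewrite !mxE; apply: lt_le_trans te.
      by case: ifP => _; case: ifP => _ //; rewrite normr0.
    by rewrite mulf_eq0 (negbTE z0) => /eqP.
  have [[e1 e10 h1]|[e1 e10 h1]] := moment_gap_alternative (a0 false) (b0 false).
    by left; apply/Spartial_trivialP; exists e1 => // z w hz hw _ _; exact: h1.
  have [[e2 e20 h2]|[e2 e20 h2]] := moment_gap_alternative (a0 true) (b0 true).
    by right; apply/Spartial_trivialP; exists e2 => // z w hz hw _ _; exact: h2.
  (* If neither gap vanishes near the origin, a point is chosen where both are nonzero. Halving a
     positive radius gives a concrete nonzero value, first for [w], then for [z], whose admissible
     radii depend on [w]. *)
  have half (s : C) : 0 < s -> [/\ s / 2 != 0, `|s / 2| < s & 0 < s].
    move=> s0; have s2 : 0 < s / 2 by rewrite divr_gt0 // ltr0n.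
    by rewrite gt_eqF // gtr0_norm // ltr_pdivrMr ?ltr0n // ltr_pMr // ltr1n.
  have [u u0 [ue1 u']] := exists_pos_lower e10 e20.
  have [v v0 [vu vt]] := exists_pos_lower u0 t0.
  have [w0 wv _] := half v v0; set w := v / 2 in w0 wv.
  have [f1 f10 g1] := h1 w (lt_le_trans wv (le_trans vu ue1)) w0.
  have [f2 f20 g2] := h2 w (lt_le_trans wv (le_trans vu u')) w0.
  have [r r0 [r1 r2]] := exists_pos_lower f10 f20.
  have [s s0 [sr st]] := exists_pos_lower r0 t0.
  have [z0 zs _] := half s s0; set z := s / 2 in z0 zs.
  have := gap z w (lt_le_trans zs st) (lt_le_trans wv vt) z0 w0.
  move=> /eqP; rewrite mulf_eq0.
  rewrite (negbTE (g1 z (lt_le_trans zs (le_trans sr r1)) z0)).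
  by rewrite (negbTE (g2 z (lt_le_trans zs (le_trans sr r2)) z0)).
move=> trivial_or.
have [e e0 he] : exists2 e, 0 < e & forall z w, `|z| < e -> `|w| < e -> z != 0 -> w != 0 ->
    moment_gap phi (a false) (b false) z w * moment_gap phi (a true) (b true) z w = 0.
  case: trivial_or => /Spartial_trivialP [e e0 he]; exists e => // z w hz hw z0 w0.
    by rewrite he // mul0r.
  by rewrite he // mulr0.
have [t t0 [td te]] := exists_pos_lower d0 e0.
apply/near_matrix0P; exists t => // G hG /upper2_eta GE; rewrite GE => /upper2_unit [z0 w0].
apply/hd; rewrite ?he ?mulr0 //.
1,2: exact: lt_le_trans td.
all: exact: lt_le_trans te.
Qed.

End Equivalence.

(** * The complex numbers satisfy the two assumptions on the scalars *)

Section ComplexField.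
Variable R : realType.

Lemma real_pow2_small : pow2_small R.
Proof.
move=> e e0; have h : `|2^-1 : R| < 1.
  by rewrite ger0_norm ?invr_ge0 ?ler0n // invf_lt1 ?ltr0n // ltr1n.
have /cvgrPdist_lt /(_ e e0) [n _ hn] := cvg_expr h.
by exists n; have := hn n (leqnn n); rewrite /= sub0r normrN ger0_norm.
Qed.

Lemma real_geometric_complete : @geometric_complete R R.
Proof. exact: (@complete_geometric R real_pow2_small R). Qed.

Local Open Scope complex_scope.

Lemma complex_pow2 n : (2^-1 : cplx R) ^+ n = ((2^-1 : R) ^+ n)%:C.
Proof. by rewrite -[2^-1 : cplx R](_ : (2^-1 : R)%:C = _) ?rmorphXn // fmorphV rmorph_nat. Qed.

Lemma complex_pow2_small : pow2_small (cplx R).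
Proof.
move=> [er ei]; rewrite ltcE /= => /andP[/eqP -> er0].
have [n hn] := real_pow2_small er0; exists n.
by rewrite complex_pow2 ltcE /= eqxx.
Qed.

Lemma normc_ge_Im (x : R[i]) : `|complex.Im x|%:C <= `|x|.
Proof. by rewrite normc_def lecR -sqrtr_sqr ler_wsqrtr // lerDr sqr_ge0. Qed.

Lemma normc_le_ReIm (x : R[i]) : `|x| <= (`|complex.Re x| + `|complex.Im x|)%:C.
Proof.
rewrite normc_def lecR -[leRHS]ger0_norm ?addr_ge0 // -sqrtr_sqr ler_wsqrtr //.
rewrite sqrrD !real_normK ?num_real // -addrA lerD2l lerDr.
by rewrite mulrn_wge0 // mulr_ge0.
Qed.

(** The bound [k] is nonnegative, hence real, so real and imaginary parts are geometric sequences of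
    reals; their rates add up. *)
Lemma complex_geometric_complete : @geometric_complete (cplx R) (cplx R).
Proof.
move=> s k hs.
have k0 : 0 <= k.
  by have := le_trans (normr_ge0 _) (hs 0%N); rewrite expr0 mulr1.
have [kr kE] : exists kr : R, k = kr%:C.
  by case: k k0 {hs} => kr ki; rewrite lecE /= => /andP[/eqP -> _]; exists kr.
have hn n : `|s n.+1 - s n| <= (kr * (2^-1) ^+ n)%:C.
  by rewrite rmorphM /= -complex_pow2 -kE.
have le_real (x : R) (y : R) (c : cplx R) : x%:C <= c -> c <= y%:C -> x <= y.
  by move=> h1 h2; have := le_trans h1 h2; rewrite lecR.
have hre n : `|complex.Re (s n.+1) - complex.Re (s n)| <= kr * (2^-1) ^+ n.
  apply: le_real (hn n); rewrite -raddfB /=; exact: normc_ge_Re.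
have him n : `|complex.Im (s n.+1) - complex.Im (s n)| <= kr * (2^-1) ^+ n.
  apply: le_real (hn n); rewrite -raddfB /=; exact: normc_ge_Im.
have [lr [Kr hr]] := real_geometric_complete hre.
have [li [Ki hi]] := real_geometric_complete him.
exists (lr +i* li), ((Kr + Ki)%:C) => n.
have -> : (Kr + Ki)%:C * (2^-1) ^+ n = ((Kr + Ki) * (2^-1) ^+ n)%:C.
  by rewrite complex_pow2 rmorphM.
apply: le_trans (normc_le_ReIm _) _; rewrite lecR mulrDl !raddfB /=.
by rewrite lerD // ?hr ?hi.
Qed.

End ComplexField.

Theorem theorem2p3 (R : realType) (A : vonNeumannAlgebra (cplx R))
    (phi : {scalar A}) (phi_state : is_state phi) (a1 b1 a2 b2 : A)
    (ab_bifree : bifree phi a1 b1 a2 b2)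
    (ab1_neq0 : phi a1 * phi b1 != 0) (ab2_neq0 : phi a2 * phi b2 != 0) :
  let X1 := diag2 a1 b1 in
  let X2 := diag2 a2 b2 in
  (\forall G \near (0 : 'M[cplx R]_2), is_upper2 G -> G \in unitmx ->
     SM phi (X1 *m X2) G =
     SM phi X2 G *m
       SM phi X1 (invmx (SM phi X2 G) *m G *m SM phi X2 G))
  <->
  ((\forall z \near (0 : cplx R) & w \near (0 : cplx R),
      z != 0 -> w != 0 -> Spartial phi a1 b1 z w = 1) \/
   (\forall z \near (0 : cplx R) & w \near (0 : cplx R),
      z != 0 -> w != 0 -> Spartial phi a2 b2 z w = 1)).
Proof.
move: ab1_neq0 ab2_neq0; rewrite !mulf_eq0 !negb_or.
move=> /andP[a1_0 b1_0] /andP[a2_0 b2_0] X1 X2.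
by apply: (@bifree_S_identity _ _ (@complex_pow2_small R) (@complex_geometric_complete R)
  phi phi_state (fun i => if i then a2 else a1) (fun i => if i then b2 else b1)) => // -[].
Qed.
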